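(* Let $\mathcal R$ be a closed class of rational functions. Suppose that for any $P\in\mathcal R$ and any special double decomposition $P=V\circ V_1=W\circ W_1$ of $P$ the following condition holds: for any maximal decomposition $\mathcal V$ of $V$ and any maximal decomposition $\mathcal W$ of $W$ the maximal decompositions $\mathcal V\circ V_1$ and $\mathcal W\circ W_1$ of $P$ are weakly equivalent. Then $\mathcal R$ is a Ritt class.
   Context: All rational functions are nonconstant, with complex coefficients. A rational function $F$ is indecomposable if it has degree greater than 1 and $F=F_2\circ F_1$ with rational $F_1,F_2$ implies that one of $F_1,F_2$ has degree one. A maximal decomposition of $F$ is a representation $F=F_r\circ\dots\circ F_1$ with all $F_i$ indecomposable of degree greater than one. Two decompositions with equal number of terms $F=F_r\circ\dots\circ F_1=G_r\circ\dots\circ G_1$ are equivalent ($\sim$) if either $r=1$ and $F_1=G_1$, or $r\ge2$ and there are rational functions $\mu_i$, $1\le i\le r-1$, of degree 1 with $F_r=G_r\circ\mu_{r-1}$, $F_i=\mu_i^{-1}\circ G_i\circ\mu_{i-1}$ ($1<i<r$), $F_1=\mu_1^{-1}\circ G_1$. If $\mathcal V$: $V=V^{(k)}\circ\dots\circ V^{(1)}$ is a decomposition of $V$ and $V_1$ is indecomposable, $\mathcal V\circ V_1$ denotes the decomposition $V^{(k)}\circ\dots\circ V^{(1)}\circ V_1$. A set $\mathcal R$ of rational functions is a closed class if for any $F\in\mathcal R$ the equality $F=G\circ H$ implies $G\in\mathcal R$, $H\in\mathcal R$. Two maximal decompositions $\mathcal D,\mathcal E$ of a rational function $F$ are weakly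 equivalent if there is a chain of maximal decompositions $\mathcal F_i$, $1\le i\le s$, of $F$ such that $\mathcal F_1=\mathcal D$, $\mathcal F_s\sim\mathcal E$, and $\mathcal F_{i+1}$ is obtained from $\mathcal F_i$, $1\le i\le s-1$, by replacing two successive functions $A\circ C$ in $\mathcal F_i$ by new functions $B\circ D$ such that $A\circ C=B\circ D$. A closed class $\mathcal R$ is a Ritt class if for any $F\in\mathcal R$ any two maximal decompositions of $F$ are weakly equivalent. A pair of rational functions $A,B$ is reducible if the diagonal monodromy action of $\pi_1(\mathbb{CP}^1\setminus S,z_0)$ on $A^{-1}\{z_0\}\times B^{-1}\{z_0\}$ is not transitive, where $S$ is a finite set containing all critical values of $A$ and $B$ and $z_0\in\mathbb{CP}^1\setminus S$ (equivalently, the affine curve $P_1(x)Q_2(y)-P_2(x)Q_1(y)=0$ is reducible, where $A=P_1/P_2$, $B=Q_1/Q_2$ in lowest terms). A double decomposition $H=A\circ C=B\circ D$ of a rational function $H$ is special if $C,D$ are indecomposable, the pair $A,B$ is reducible, and there exist no rational functions $\tilde A,\tilde B,U$ with $\deg U>1$ such that $A=U\circ\tilde A$, $B=U\circ\tilde B$, $\tilde A\circ C=\tilde B\circ D$. *)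

(* Defs.v *)
From HB Require Import structures.
From mathcomp Require Import all_boot all_order all_algebra.
From mathcomp Require Import complex.
From mathcomp Require Import all_classical all_reals all_analysis.

Set Implicit Arguments.
Unset Strict Implicit.
Unset Printing Implicit Defensive.

Import Order.TTheory GRing.Theory Num.Theory.
Import numFieldNormedType.Exports.

Local Open Scope classical_set_scope.
Local Open Scope ring_scope.

Definition ratfun (R : realType) : Type := {fraction {poly R[i]}}.

(* The Riemann sphere; [None] is the point at infinity.  [R[i]^o] carries the
   usual topology of the complex plane (the one defined by the modulus). *)
Definition P1 (R : realType) : topologicalType :=
  one_point_compactification (R[i]^o).

Section RationalFunctions.
Context {R : realType}.
Implicit Types F G H A B C D U V W : ratfun R.

(* Numerator and denominator in lowest terms; they are determined up to a
   common nonzero constant, which plays no role below. *)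
Definition numer F : {poly R[i]} :=
  (frac (repr F)).1 %/ gcdp (frac (repr F)).1 (frac (repr F)).2.
Definition denom F : {poly R[i]} :=
  (frac (repr F)).2 %/ gcdp (frac (repr F)).1 (frac (repr F)).2.

Definition degree F : nat := (maxn (size (numer F)) (size (denom F))).-1.

Definition nonconstant F : Prop := (0 < degree F)%N.

Definition ratX : ratfun R := tofrac ('X : {poly R[i]}).

(* [F \oR G] is [F o G], that is [P(G) / Q(G)] for [F = P / Q].  It is the
   composition whenever [G] is nonconstant, which is always required below. *)
Definition ratcomp F G : ratfun R :=
  (map_poly (@tofrac _ \o polyC) (numer F)).[G]
  / (map_poly (@tofrac _ \o polyC) (denom F)).[G].

End RationalFunctions.

Notation "F \oR G" := (ratcomp F G) (at level 50, left associativity).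

Section Sphere.
Context {R : realType}.
Implicit Types F A B : ratfun R.

Definition rateval_fin F (z : R[i]) : P1 R :=
  if (denom F).[z] == 0 then None else Some ((numer F).[z] / (denom F).[z]).

(* At infinity one uses the coordinate [1 / z]. *)
Definition rateval F (p : P1 R) : P1 R :=
  if p is Some z then rateval_fin F z else rateval_fin (F \oR ratX^-1) 0.

(* Up to the nonzero factor [Q(z)^2] (resp. [P(z)^2]) and sign, for [F = P / Q]
   this is the derivative of [F] (resp. of [1 / F], if [z] is a pole of [F]). *)
Definition wronskian F (z : R[i]) : R[i] :=
  (numer F)^`().[z] * (denom F).[z] - (numer F).[z] * (denom F)^`().[z].

Definition critical_point F (p : P1 R) : Prop :=
  if p is Some z then wronskian F z = 0 else wronskian (F \oR ratX^-1) 0 = 0.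

Definition critical_value F : set (P1 R) :=
  [set rateval F p | p in critical_point F].

(* Only the restriction of a path to [0, 1] matters. *)
Definition is_path (g : R -> P1 R) (x y : P1 R) : Prop :=
  [/\ {within `[0, 1], continuous g}, g 0 = x & g 1 = y].

Definition is_loop_in (E : set (P1 R)) (z0 : P1 R) (g : R -> P1 R) : Prop :=
  is_path g z0 z0 /\ forall t, t \in `[0, 1] -> E (g t).

(* [monodromy F g a a']: the loop [g] sends the point [a] of the fibre of [F]
   to [a'], i.e. the lift of [g] along [F] starting at [a] ends at [a']. *)
Definition monodromy F (g : R -> P1 R) (a a' : P1 R) : Prop :=
  exists2 h : R -> P1 R,
    is_path h a a' & forall t, t \in `[0, 1] -> rateval F (h t) = g t.

(* Transitivity of the diagonal action of [pi_1 (P1 \ S, z0)] on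
   [A^{-1} {z0} x B^{-1} {z0}]. *)
Definition diagonal_transitive A B (S : set (P1 R)) (z0 : P1 R) : Prop :=
  forall a a' b b' : P1 R,
    rateval A a = z0 -> rateval A a' = z0 -> rateval B b = z0 -> rateval B b' = z0 ->
    exists g : R -> P1 R,
      [/\ is_loop_in (~` S) z0 g, monodromy A g a a' & monodromy B g b b'].

(* Whether the action is transitive does not depend on [S] and [z0]. *)
Definition reducible_pair A B : Prop :=
  exists (S : set (P1 R)) (z0 : P1 R),
    [/\ finite_set S, critical_value A `<=` S, critical_value B `<=` S,
        ~ S z0 & ~ diagonal_transitive A B S z0].

End Sphere.

Section Decompositions.
Context {R : realType}.
Implicit Types F G H A B C D U V W : ratfun R.
Implicit Types s t : seq (ratfun R).

Definition indecomposable F : Prop :=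
  (1 < degree F)%N /\
  forall F1 F2, nonconstant F1 -> nonconstant F2 -> F = F2 \oR F1 ->
    degree F1 = 1%N \/ degree F2 = 1%N.

(* A decomposition [F_r o ... o F_1] is the sequence [:: F_r; ...; F_1]. *)
Definition composite s : ratfun R := foldr ratcomp ratX s.

Definition maximal_decomposition F s : Prop :=
  [/\ s != [::], forall G, G \in s -> indecomposable G & F = composite s].

(* The index-[i] term [F_i] of [:: F_r; ...; F_1], for [1 <= i <= r]. *)
Definition dterm s (i : nat) : ratfun R := nth ratX (rev s) i.-1.

Definition equivalent s t : Prop :=
  let r := size s in
  size t = r /\
  ((r = 1%N /\ dterm s 1%N = dterm t 1%N) \/
   ((2 <= r)%N /\
    exists mu mu_inv : nat -> ratfun R,
      [/\ forall i, (1 <= i <= r.-1)%N ->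
            [/\ degree (mu i) = 1%N, degree (mu_inv i) = 1%N,
                mu i \oR mu_inv i = ratX & mu_inv i \oR mu i = ratX],
          dterm s r = dterm t r \oR mu r.-1,
          forall i, (1 < i < r)%N ->
            dterm s i = mu_inv i \oR dterm t i \oR mu i.-1
        & dterm s 1%N = mu_inv 1%N \oR dterm t 1%N])).

Definition elementary_step s t : Prop :=
  exists (u v : seq (ratfun R)) A B C D,
    [/\ s = u ++ [:: A; C] ++ v, t = u ++ [:: B; D] ++ v
      & A \oR C = B \oR D].

(* [F_(i+1)] of the chain is [c i], for [0 <= i <= n], so that [s = n.+1]. *)
Definition weakly_equivalent F (d e : seq (ratfun R)) : Prop :=
  exists (n : nat) (c : nat -> seq (ratfun R)),
    [/\ forall i, (i <= n)%N -> maximal_decomposition F (c i),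
        c 0%N = d, equivalent (c n) e
      & forall i, (i < n)%N -> elementary_step (c i) (c i.+1)].

Definition closed_class (K : set (ratfun R)) : Prop :=
  (forall F, K F -> nonconstant F) /\
  (forall F G H, K F -> nonconstant G -> nonconstant H -> F = G \oR H ->
     K G /\ K H).

Definition ritt_class (K : set (ratfun R)) : Prop :=
  closed_class K /\
  forall F d e, K F -> maximal_decomposition F d ->
    maximal_decomposition F e -> weakly_equivalent F d e.

Definition double_decomposition H A C B D : Prop :=
  [/\ nonconstant A, nonconstant C, nonconstant B & nonconstant D] /\
  (H = A \oR C /\ H = B \oR D).

Definition special_double_decomposition H A C B D : Prop :=
  [/\ double_decomposition H A C B D,
      indecomposable C /\ indecomposable D,
      reducible_pair A B
    & ~ (exists A' B' U,
          [/\ nonconstant A', nonconstant B', (1 < degree U)%N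
            & [/\ A = U \oR A', B = U \oR B' & A' \oR C = B' \oR D]])].

End Decompositions.

(* Main.v *)
Require Import Defs.
From HB Require Import structures.
From Stdlib Require Import Relations.
From mathcomp Require Import all_boot all_order all_algebra all_field.
From mathcomp Require Import complex ring.
From mathcomp Require Import all_classical all_reals all_analysis.

(** The proof compares two maximal decompositions [V o V1] and [W o W1] of a
    function [F] of the class, by induction on the degree of [F].

    If [V = U o A'] and [W = U o B'] with [A' o V1 = B' o W1] and [degree U > 1],
    the induction hypothesis applies to [V], to [A' o V1] and to [W], and links
    the two decompositions; when [A'] or [B'] has degree 1, the functions [V1]
    and [W1] differ by a function of degree 1, and the induction hypothesis for
    [V] or [W] is enough.  If there is no such common left factor and the pair
    [V], [W] is reducible, the double decomposition is special and the
    hypothesis applies.  The remaining case is the heart of the matter: if the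
    pair [V], [W] is irreducible and there is no common left factor, then [V]
    and [W] are indecomposable, and one elementary step leads from one
    decomposition to the other.

    Let us see why, with [A o C = B o D], the pair [A], [B] irreducible and [D]
    indecomposable.  Let [k] be the field of complex numbers and write
    [A = P / Q].  The polynomial [P(x) - B(y) Q(x)] is irreducible over [k(y)]
    (lemma [fibre_poly_irreducible]): given a nontrivial factorization, a path
    in the fibre product of [A] and [B], that is a pair of lifts of one loop,
    cannot go from the zeros of the first factor to those of the second one.
    Indeed both zero sets are closed, they cover the path, and they are
    disjoint because a common zero is a critical point of [A]; this contradicts
    the connectedness of the unit interval.  Hence [C] has degree at least
    [degree A] over the field [k(D)].  Now suppose that [A = A2 o A1] with both
    degrees greater than 1, and put [e = A1 o C], which has degree at most
    [degree A2] over [k(D)].  By Lueroth's theorem [k(D, e) = k(G)] for some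
    [G], and as [D] is indecomposable, [k(G)] is [k(z)] or [k(D)].  In the first
    case [C] lies in [k(D, e)], so it has degree at most
    [degree A2 < degree A] over [k(D)], a contradiction.  In the second case [e]
    is a function of [D] and [A2] is a common left factor of [A] and [B].

    Lueroth's theorem is proved by the classical comparison of bidegrees: the
    minimal polynomial of [z] over a subfield [L], with denominators cleared,
    divides [P(x) Q(y) - P(y) Q(x)], where [P / Q] is one of its nonconstant
    coefficients.  As [k] is algebraically closed, Gauss's lemma reduces to
    evaluating [y] at points of [k]. *)

Set Implicit Arguments.
Unset Strict Implicit.
Unset Printing Implicit Defensive.

Import Order.TTheory GRing.Theory Num.Theory.
Import numFieldNormedType.Exports.

Local Open Scope ring_scope.

(** * The field of rational functions and composition *)

Lemma frac_reprE (A : idomainType) (F : {fraction A}) :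
  F = tofrac (frac (repr F)).1 / tofrac (frac (repr F)).2.
Proof.
have d0 := denom_ratioP (repr F).
apply: (canRL (mulfK _)); first by rewrite tofrac_eq0.
rewrite -{1}[F]reprK; move: (repr F) d0 => r d0.
unlock FracField.tofrac; rewrite -[LHS]FracField.pi_mul.
apply/eqP; rewrite piE /= FracField.equivfE /FracField.mulf.
by rewrite !numden_Ratio ?mulf_neq0 ?oner_eq0 // !mulr1 mulrC.
Qed.

(** The embedding of the constants into the rational functions, and its action
    on the coefficients of a polynomial. *)
Notation ratC := (@tofrac _ \o polyC).
Notation "p ^E" := (map_poly ratC p) (at level 2, format "p ^E").

Section Basics.
Context {R : realType}.
Implicit Types (p q a b : {poly R[i]}) (F G H D : ratfun R) (c z : R[i]).

Lemma denom_neq0 F : denom F != 0.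
Proof.
by rewrite /denom dvdp_div_eq0 ?dvdp_gcdr ?denom_ratioP.
Qed.

Lemma coprime_numer_denom F : coprimep (numer F) (denom F).
Proof. by apply: coprimep_div_gcd; rewrite denom_ratioP orbT. Qed.

Lemma numer_denomE F : F = tofrac (numer F) / tofrac (denom F).
Proof.
rewrite {1}[F]frac_reprE /numer /denom; set n := (frac _).1; set d := (frac _).2.
have d0 : d != 0 by apply: denom_ratioP.
set g := gcdp n d.
have g0 : g != 0 by rewrite gcdp_eq0 (negPf d0) andbF.
have -> : tofrac n = tofrac (n %/ g) * tofrac g by rewrite -rmorphM divpK ?dvdp_gcdl.
have -> : tofrac d = tofrac (d %/ g) * tofrac g by rewrite -rmorphM divpK ?dvdp_gcdr.
by rewrite -mulf_div divff ?mulr1 // tofrac_eq0.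
Qed.

Lemma eq_frac p q p' q' : q != 0 -> q' != 0 ->
  tofrac p / tofrac q = tofrac p' / tofrac q' -> p * q' = p' * q.
Proof.
move=> q0 q'0 /eqP; rewrite eqr_div ?tofrac_eq0 // -!rmorphM tofrac_eq.
by move/eqP.
Qed.

Lemma frac_lowest p q : q != 0 -> coprimep p q ->
  exists c, [/\ c != 0, numer (tofrac p / tofrac q) = c *: p
               & denom (tofrac p / tofrac q) = c *: q].
Proof.
move=> q0 cpq; set F := _ / _.
have cPQ := coprime_numer_denom F.
have PQ := @eq_frac _ _ _ _ (denom_neq0 F) q0 (esym (numer_denomE F)).
have : denom F %= q.
  apply/andP; split.
    rewrite coprimep_sym in cPQ.
    by rewrite -(Gauss_dvdpr _ cPQ) PQ dvdp_mull.
  rewrite coprimep_sym in cpq.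
  by rewrite -(Gauss_dvdpr _ cpq) -PQ dvdp_mull.
case/eqpf_eq => c c0 E; exists c; split=> //.
by apply: (mulIf q0); rewrite PQ E -scalerAl -scalerAr.
Qed.

Lemma degree_frac p q : q != 0 -> coprimep p q ->
  degree (tofrac p / tofrac q : ratfun R) = (maxn (size p) (size q)).-1.
Proof.
move=> q0 cpq; rewrite /degree.
by have [c [c0 -> ->]] := frac_lowest q0 cpq; rewrite !size_scale.
Qed.

Lemma degree_ratC c : degree (ratC c : ratfun R) = 0%N.
Proof.
rewrite /= -[tofrac _]divr1 -(rmorph1 (@tofrac _)).
rewrite degree_frac; [|exact: oner_neq0|exact: coprimep1].
have c1 : (size c%:P <= size (1%R : {poly R[i]}))%N.
  by rewrite [X in (_ <= X)%N]size_poly1 size_polyC_leq1.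
by rewrite (maxn_idPr c1) size_poly1.
Qed.

Lemma degree_ratX : degree (@ratX R) = 1%N.
Proof.
rewrite /ratX -[tofrac _]divr1 -(rmorph1 (@tofrac _)).
rewrite degree_frac; [|exact: oner_neq0|exact: coprimep1].
by rewrite size_poly1 size_polyX.
Qed.

Lemma nonconstantP F : nonconstant F <-> forall c, F <> ratC c.
Proof.
split=> [F0 c Fc|Fc]; first by move: F0; rewrite /nonconstant Fc degree_ratC.
rewrite /nonconstant lt0n; apply/negP => /eqP F0.
have : (maxn (size (numer F)) (size (denom F)) <= 1)%N.
  by move: F0; rewrite /degree; case: maxn => [|[]].
rewrite geq_max => /andP[/size1_polyC n1 /size1_polyC d1].
apply: (Fc ((numer F)`_0 / (denom F)`_0)).
rewrite [LHS]numer_denomE {1}n1 {1}d1.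
by rewrite [RHS](fmorph_div (@tofrac _ \o polyC)).
Qed.

Lemma nonconstant_ratX : nonconstant (@ratX R).
Proof. by rewrite /nonconstant degree_ratX. Qed.
Hint Resolve nonconstant_ratX : core.

(** A nonconstant rational function is transcendental over the constants,
    because the field of constants is algebraically closed. *)
Lemma horner_ratC_neq0 D p : nonconstant D -> p != 0 -> p^E.[D] != 0.
Proof.
move=> D0 p0; have [r ->] := closed_field_poly_normal p.
rewrite map_polyZ hornerZ mulf_neq0 //.
  by rewrite fmorph_eq0 lead_coef_eq0.
rewrite rmorph_prod horner_prod prodf_seq_neq0; apply/allP => z _ /=.
rewrite rmorphB /= map_polyX map_polyC hornerXsubC subr_eq0.
by apply/eqP; move/nonconstantP: D0; apply.
Qed.

Lemma horner_ratC_ratX p : p^E.[ratX] = tofrac p :> ratfun R.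
Proof.
rewrite /ratX (map_poly_comp (@tofrac _)) horner_map; congr tofrac.
exact: comp_polyXr.
Qed.

Lemma ratcomp_frac p q D : nonconstant D -> q != 0 ->
  (tofrac p / tofrac q) \oR D = p^E.[D] / q^E.[D].
Proof.
move=> D0 q0; rewrite /ratcomp; set F := tofrac p / tofrac q.
have PQ := @eq_frac _ _ _ _ (denom_neq0 F) q0 (esym (numer_denomE F)).
apply/eqP; rewrite eqr_div ?horner_ratC_neq0 ?denom_neq0 //.
by rewrite -!hornerM -!rmorphM PQ.
Qed.

Lemma ratcomp_tofrac p D : nonconstant D -> tofrac p \oR D = p^E.[D].
Proof.
move=> D0; rewrite -[tofrac p]divr1 -(rmorph1 (@tofrac _)) ratcomp_frac ?oner_eq0 //.
by rewrite rmorph1 hornerC divr1.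
Qed.

Lemma ratcomp_ratC c D : nonconstant D -> ratC c \oR D = ratC c.
Proof. by move=> D0; rewrite ratcomp_tofrac // map_polyC hornerC. Qed.

Lemma ratcompX F : F \oR ratX = F.
Proof. by rewrite /ratcomp !horner_ratC_ratX -numer_denomE. Qed.

Lemma ratXcomp D : nonconstant D -> ratX \oR D = D.
Proof. by move=> D0; rewrite ratcomp_tofrac // map_polyX hornerX. Qed.

(** Composition on the right with a nonconstant [D], as a field embedding of
    the field of rational functions into itself. *)
Definition rcomp D (D0 : nonconstant D) F : ratfun R := F \oR D.

Section RightComposition.
Variables (D : ratfun R) (D0 : nonconstant D).

Lemma rcomp_is_zmod_morphism : zmod_morphism (rcomp D0).
Proof.
move=> F G; rewrite /rcomp [F]numer_denomE [G]numer_denomE.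
have [d0 e0] := (denom_neq0 F, denom_neq0 G).
rewrite -mulNr -rmorphN addf_div ?tofrac_eq0 // -!rmorphM -rmorphD.
rewrite !ratcomp_frac ?mulf_neq0 //.
rewrite -mulNr addf_div ?horner_ratC_neq0 //.
by rewrite rmorphD /= !rmorphM /= rmorphN /= hornerD !hornerM hornerN.
Qed.
HB.instance Definition _ := GRing.isZmodMorphism.Build (ratfun R) (ratfun R)
  (rcomp D0) rcomp_is_zmod_morphism.

Lemma rcomp_is_monoid_morphism : monoid_morphism (rcomp D0).
Proof.
split=> [|F G]; rewrite /rcomp.
  by rewrite -(rmorph1 (@tofrac _)) ratcomp_tofrac // !rmorph1 hornerE.
rewrite [F]numer_denomE [G]numer_denomE.
have [d0 e0] := (denom_neq0 F, denom_neq0 G).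
rewrite mulf_div -!rmorphM !ratcomp_frac ?mulf_neq0 // mulf_div.
by rewrite !rmorphM /= !hornerM.
Qed.
HB.instance Definition _ := GRing.isMonoidMorphism.Build (ratfun R) (ratfun R)
  (rcomp D0) rcomp_is_monoid_morphism.

End RightComposition.

Lemma ratcomp_inj D : nonconstant D -> injective (ratcomp^~ D).
Proof. by move=> D0 F G /(fmorph_inj (rcomp D0)). Qed.

Lemma ratcomp_nonconstant F G : nonconstant F -> nonconstant G ->
  nonconstant (F \oR G).
Proof.
move=> /nonconstantP F0 G0; apply/nonconstantP => c.
by rewrite -(ratcomp_ratC c G0) => /(ratcomp_inj G0); apply: F0.
Qed.

Lemma horner_ratC_ratcomp p G H : nonconstant H ->
  p^E.[G] \oR H = p^E.[G \oR H].
Proof.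
move=> H0; rewrite -[LHS]/(rcomp H0 _) -horner_map -map_poly_comp.
congr (_.[_]); apply: eq_map_poly => c /=; exact: ratcomp_ratC.
Qed.

Lemma ratcompA F G H : nonconstant G -> nonconstant H ->
  F \oR (G \oR H) = F \oR G \oR H.
Proof.
move=> G0 H0; have GH0 := ratcomp_nonconstant G0 H0.
rewrite {2}/ratcomp -[RHS]/(rcomp H0 _) fmorph_div /= /rcomp.
by rewrite !horner_ratC_ratcomp.
Qed.

End Basics.
#[export] Hint Resolve nonconstant_ratX : core.

(** * Multiplicativity of the degree *)

Section TopCoefficients.
Variable A : comNzRingType.
Implicit Types p q : {poly A}.

Lemma coef_mul_top p q d e : (size p <= d.+1)%N -> (size q <= e.+1)%N ->
  (p * q)`_(d + e) = p`_d * q`_e.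
Proof.
move=> pd qe; rewrite coefM.
have dl : (d < (d + e).+1)%N by rewrite ltnS leq_addr.
rewrite (bigD1 (Ordinal dl)) //= addKn big1 ?addr0 // => i /negPf.
rewrite -val_eqE /= => id; case: (ssrnat.ltngtP i d) id => // id _.
  by rewrite [q`__]nth_default ?mulr0 //; apply: leq_trans qe _; rewrite ltn_subRL ltn_add2r.
by rewrite nth_default ?mul0r // (leq_trans pd).
Qed.

Lemma size_exp_top p d i : (size p <= d.+1)%N -> (size (p ^+ i) <= (d * i).+1)%N.
Proof.
move=> pd; apply: leq_trans (size_poly_exp_leq _ _) _.
by rewrite ltnS leq_mul2r; apply/orP; right; case: size pd.
Qed.

Lemma coef_exp_top p d i : (size p <= d.+1)%N -> (p ^+ i)`_(d * i) = p`_d ^+ i.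
Proof.
move=> pd; elim: i => [|i IH]; first by rewrite muln0 !expr0 coef1.
by rewrite !exprS mulnS coef_mul_top ?IH // size_exp_top.
Qed.

End TopCoefficients.

(** The value at [(a, b)] of the homogenization of degree [n] of [p], for [a]
    and [b] in an algebra; both scalars and polynomials are needed below. *)
Definition homog (K : comNzRingType) (A : comAlgType K) n (p : {poly K}) (a b : A) : A :=
  \sum_(i < n.+1) p`_i *: (a ^+ i * b ^+ (n - i)).

Lemma homog_term (K : fieldType) (x y z w : K) : w != 0 ->
  x * (y * z) = z * w * (x * (y / w)).
Proof. by move=> w0; field. Qed.

Lemma mulf_cancell (K : fieldType) (x y z : K) : x != 0 ->
  x * y / (x * z) = y / z.
Proof. by move=> x0; rewrite -mulf_div divff // mul1r. Qed.

Section Degree.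
Context {R : realType}.
Implicit Types (p q a b : {poly R[i]}) (F G H D : ratfun R) (c z u v : R[i]).

(** The homogenizations of coprime polynomials have no common zero on the
    projective line; the case [v = 0] is that of the leading coefficients. *)
Lemma homog_coprime n p q u v : coprimep p q -> maxn (size p) (size q) = n.+1 ->
  homog n p (u : R[i]^o) v = 0 -> homog n q (u : R[i]^o) v = 0 -> u = 0 /\ v = 0.
Proof.
move=> cpq spq; have [pn qn] : (size p <= n.+1)%N /\ (size q <= n.+1)%N.
  by rewrite -spq leq_maxl leq_maxr.
have [-> | v0] := eqVneq v 0.
  have E (r : {poly R[i]}) : homog n r (u : R[i]^o) 0 = r`_n * u ^+ n.
    rewrite /homog big_ord_recr /= subnn expr0 mulr1 big1 ?add0r // => i _.
    by rewrite expr0n subn_eq0 leqNgt ltn_ord /= mulr0 scaler0.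
  rewrite !E; have [->//|u0] := eqVneq u 0.
  move=> /eqP; rewrite mulf_eq0 expf_eq0 (negPf u0) andbF orbF => /eqP p0.
  move=> /eqP; rewrite mulf_eq0 expf_eq0 (negPf u0) andbF orbF => /eqP q0.
  suff : (maxn (size p) (size q) <= n)%N by rewrite spq ltnn.
  rewrite geq_max; apply/andP; split; apply/leq_sizeP => j.
    by rewrite leq_eqVlt => /orP[/eqP<-//|nj]; rewrite nth_default // (leq_trans pn).
  by rewrite leq_eqVlt => /orP[/eqP<-//|nj]; rewrite nth_default // (leq_trans qn).
have E (r : {poly R[i]}) : (size r <= n.+1)%N -> homog n r (u : R[i]^o) v = v ^+ n * r.[u / v].
  move=> rn; rewrite (horner_coef_wide _ rn) mulr_sumr; apply: eq_bigr => i _.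
  rewrite -[_ *: _]/(_ * _) expr_div_n -[in v ^+ n](subnK (ltn_ord i : (i <= n)%N)) exprD.
  by rewrite (@homog_term _ _ _ _ (v ^+ i)) ?expf_neq0.
rewrite !E // => /eqP; rewrite mulf_eq0 expf_eq0 (negPf v0) andbF /= => pr.
move=> /eqP; rewrite mulf_eq0 expf_eq0 (negPf v0) andbF /=; move: pr.
by move=> /(coprimep_root cpq) /negPf ->.
Qed.

Lemma horner_homog n p a b z :
  (homog n p a b).[z] = homog n p (a.[z] : R[i]^o) b.[z].
Proof.
rewrite /homog horner_sum; apply: eq_bigr => i _.
by rewrite hornerZ hornerM !horner_exp.
Qed.

(** The coefficient in the largest possible degree is a value of the same form,
    which plays the role of the value at infinity. *)
Lemma size_coef_homog n p a b d : (size a <= d.+1)%N -> (size b <= d.+1)%N ->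
  (size (homog n p a b) <= (d * n).+1)%N /\
  (homog n p a b)`_(d * n) = homog n p (a`_d : R[i]^o) b`_d.
Proof.
move=> ad bd; have S (i : 'I_n.+1) :
    (size (a ^+ i * b ^+ (n - i))%R <= (d * n).+1)%N /\
    (a ^+ i * b ^+ (n - i))`_(d * n) = a`_d ^+ i * b`_d ^+ (n - i).
  have := size_exp_top i ad; have := size_exp_top (n - i) bd => sb sa.
  rewrite -[in (d * n)%N](subnKC (ltn_ord i : (i <= n)%N)) mulnDr.
  rewrite coef_mul_top // !coef_exp_top //; split=> //.
  apply: leq_trans (size_polyMleq _ _) _.
  by have := leq_add sa sb; rewrite addSn addnS; case: (size _ + size _)%N.
split.
  apply: leq_trans (size_sum _ _ _) _; apply/bigmax_leqP => i _.
  by apply: leq_trans (size_scale_leq _ _) _; case: (S i).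
rewrite /homog coef_sum; apply: eq_bigr => i _.
by rewrite coefZ (proj2 (S i)).
Qed.

Lemma homog_frac n p (G : ratfun R) : nonconstant G -> (size p <= n.+1)%N ->
  tofrac (homog n p (numer G) (denom G)) = tofrac (denom G) ^+ n * p^E.[G].
Proof.
move=> G0 pn; rewrite (@horner_coef_wide _ n.+1) ?size_map_poly // mulr_sumr.
rewrite rmorph_sum; apply: eq_bigr => i _.
have d0 : tofrac (denom G) != 0 :> ratfun R by rewrite tofrac_eq0 denom_neq0.
rewrite -mul_polyC !rmorphM !rmorphXn /= coef_map {4}[G]numer_denomE.
have -> : tofrac (denom G) ^+ n = tofrac (denom G) ^+ (n - i) * tofrac (denom G) ^+ i.
  by rewrite -exprD subnK // -ltnS.
by rewrite expr_div_n (@homog_term _ _ _ _ (tofrac (denom G) ^+ i)) ?expf_neq0.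
Qed.

(** With [G = a / b] in lowest terms, homogenizing the numerator and the
    denominator of [F] at [(a, b)] gives [F o G] in lowest terms: a common root,
    or a drop of both degrees, would be a common zero of the homogenizations. *)
Lemma degree_ratcomp F G : nonconstant F -> nonconstant G ->
  degree (F \oR G) = (degree F * degree G)%N.
Proof.
move=> F0 G0; set n := degree F; set d := degree G.
have sF : maxn (size (numer F)) (size (denom F)) = n.+1.
  by move: F0; rewrite /nonconstant /n /degree; case: maxn.
have sG : maxn (size (numer G)) (size (denom G)) = d.+1.
  by move: G0; rewrite /nonconstant /d /degree; case: maxn.
have [sP sQ] : (size (numer F) <= n.+1)%N /\ (size (denom F) <= n.+1)%N.
  by rewrite -sF leq_maxl leq_maxr.
have [sa sb] : (size (numer G) <= d.+1)%N /\ (size (denom G) <= d.+1)%N.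
  by rewrite -sG leq_maxl leq_maxr.
pose h (r : {poly R[i]}) := homog n r (numer G) (denom G).
have d0 : tofrac (denom G) != 0 :> ratfun R by rewrite tofrac_eq0 denom_neq0.
have hE (r : {poly R[i]}) : (size r <= n.+1)%N -> tofrac (h r) = tofrac (denom G) ^+ n * r^E.[G].
  exact: homog_frac.
have FG : F \oR G = tofrac (h (numer F)) / tofrac (h (denom F)).
  by rewrite (hE _ sP) (hE _ sQ) mulf_cancell ?expf_neq0.
have hQ0 : h (denom F) != 0.
  have : tofrac (h (denom F)) != 0 :> ratfun R.
    rewrite (hE _ sQ); apply: mulf_neq0; first exact: expf_neq0.
    by apply: horner_ratC_neq0 => //; exact: denom_neq0.
  by rewrite tofrac_eq0.
have hc : coprimep (h (numer F)) (h (denom F)).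
  apply: Pdiv.ClosedField.root_coprimep => z; rewrite /root /h !horner_homog => /eqP hp.
  apply/eqP => hq.
  have [az bz] := homog_coprime (coprime_numer_denom F) sF hp hq.
  have := coprimep_root (coprime_numer_denom G) (x := z).
  by rewrite /root az bz eqxx => /(_ isT) /eqP.
rewrite FG degree_frac //; set m := maxn _ _.
suff -> : m = (d * n).+1 by rewrite mulnC.
have [sp cp] := size_coef_homog n (numer F) sa sb.
have [sq cq] := size_coef_homog n (denom F) sa sb.
apply/eqP; rewrite eqn_leq geq_max sp sq /= ltnNge geq_max.
apply/negP => /andP[/leq_sizeP/(_ _ (leqnn _)) + /leq_sizeP/(_ _ (leqnn _))].
rewrite cp cq => hp hq.
have [ad bd] := homog_coprime (coprime_numer_denom F) sF hp hq.
suff : (maxn (size (numer G)) (size (denom G)) <= d)%N by rewrite sG ltnn.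
rewrite geq_max; apply/andP; split; apply/leq_sizeP => j.
  by rewrite leq_eqVlt => /orP[/eqP<-//|nj]; rewrite nth_default // (leq_trans sa).
by rewrite leq_eqVlt => /orP[/eqP<-//|nj]; rewrite nth_default // (leq_trans sb).
Qed.
End Degree.

(** * Functions of degree 1 *)

Lemma moebius_identity (K : comPzRingType) (F X a b c e : K) :
  F * (e + c * X) = b + a * X -> e * F - b = X * (a - c * F).
Proof.
move=> E; apply/eqP; rewrite -subr_eq0.
have -> : e * F - b - X * (a - c * F) = F * (e + c * X) - (b + a * X) by ring.
by rewrite E subrr.
Qed.

Section Moebius.
Context {R : realType}.
Implicit Types (p q a b : {poly R[i]}) (F G H D : ratfun R) (c z u v : R[i]).

Lemma horner_ratC_size2 p D : (size p <= 2)%N ->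
  p^E.[D] = tofrac (p`_0)%:P + tofrac (p`_1)%:P * D.
Proof.
move=> p2; rewrite (@horner_coef_wide _ 2) ?size_map_poly //.
by rewrite !big_ord_recr big_ord0 /= add0r !coef_map expr0 expr1 mulr1.
Qed.

Lemma degree1_inverse F : degree F = 1%N ->
  exists G, [/\ degree G = 1%N, F \oR G = ratX & G \oR F = ratX].
Proof.
move=> F1; have F0 : nonconstant F by rewrite /nonconstant F1.
have : (maxn (size (numer F)) (size (denom F)) = 2)%N.
  by move: F1; rewrite /degree; case: maxn => [|[|[|]]].
move=> s2; have [sp sq] : (size (numer F) <= 2)%N /\ (size (denom F) <= 2)%N.
  by rewrite -s2 leq_maxl leq_maxr.
(* The inverse of [(a x + b) / (c x + e)] is [(e x - b) / (a - c x)]. *)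
pose p := (denom F)`_0 *: 'X - ((numer F)`_0)%:P.
pose q := ((numer F)`_1)%:P - (denom F)`_1 *: 'X.
have q0 : q != 0.
  apply/negP => /eqP /polyP q0; have := q0 0%N; have := q0 1%N.
  rewrite !coefB !coefC !coefZ !coefX /= mulr0 mulr1 sub0r subr0 => /eqP.
  rewrite oppr_eq0 => /eqP d1 n1.
  suff : (maxn (size (numer F)) (size (denom F)) <= 1)%N by rewrite s2.
  rewrite geq_max; apply/andP; split; apply/leq_sizeP => -[|[|j]] // _;
    by rewrite nth_default // (leq_trans sp, leq_trans sq).
pose G : ratfun R := tofrac p / tofrac q.
have GF : G \oR F = ratX.
  rewrite /G ratcomp_frac //; apply: (canLR (mulfK _)).
    exact: horner_ratC_neq0.
  have : F * (denom F)^E.[ratX] = (numer F)^E.[ratX].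
    by rewrite !horner_ratC_ratX {1}[F]numer_denomE divfK // tofrac_eq0 denom_neq0.
  rewrite (horner_ratC_size2 _ sp) (horner_ratC_size2 _ sq).
  have sZ c : (size (c *: 'X : {poly R[i]}) <= 2)%N.
    by rewrite (leq_trans (size_scale_leq _ _)) // size_polyX.
  have sC c : (size (c%:P : {poly R[i]}) <= 2)%N.
    by rewrite (leq_trans (size_polyC_leq1 _)).
  have sp' : (size p <= 2)%N.
    by rewrite (leq_trans (size_polyD _ _)) // size_polyN geq_max sZ sC.
  have sq' : (size q <= 2)%N.
    by rewrite (leq_trans (size_polyD _ _)) // size_polyN geq_max sZ sC.
  rewrite (horner_ratC_size2 _ sp') (horner_ratC_size2 _ sq').
  have -> : p`_0 = - (numer F)`_0 by rewrite coefB coefC coefZ coefX mulr0 sub0r.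
  have -> : p`_1 = (denom F)`_0 by rewrite coefB coefC coefZ coefX mulr1 subr0.
  have -> : q`_0 = (numer F)`_1 by rewrite coefB coefC coefZ coefX mulr0 subr0.
  have -> : q`_1 = - (denom F)`_1 by rewrite coefB coefC coefZ coefX mulr1 sub0r.
  rewrite !polyCN !rmorphN /=.
  move: (tofrac ((numer F)`_0)%:P) (tofrac ((numer F)`_1)%:P) => b a.
  move: (tofrac ((denom F)`_0)%:P) (tofrac ((denom F)`_1)%:P) => e c.
  by move=> /moebius_identity E; rewrite addrC E mulNr.
have G0 : nonconstant G.
  apply/nonconstantP => c Gc; have := degree_ratX (R := R).
  by rewrite -GF Gc ratcomp_ratC // degree_ratC.
exists G; split=> //.
  by have := degree_ratcomp G0 F0; rewrite GF degree_ratX F1 muln1.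
apply: (ratcomp_inj F0) => /=.
by rewrite -ratcompA // GF ratcompX ratXcomp.
Qed.

End Moebius.

(** * Polynomials in two variables over an algebraically closed field *)

Section Clearing.
Variable A : idomainType.

Lemma map_tofrac_inj : injective (map_poly (@tofrac A)).
Proof.
apply: map_inj_poly => [x y|]; last exact: rmorph0.
by move/eqP; rewrite tofrac_eq => /eqP.
Qed.

Lemma clear_denominators (p : {poly {fraction A}}) :
  exists d (P : {poly A}), d != 0 /\ map_poly (@tofrac A) P = tofrac d *: p.
Proof.
elim/poly_ind: p => [|p c [d [P [d0 PE]]]].
  by exists 1, 0; rewrite oner_eq0 rmorph0 scaler0.
have := frac_reprE c; have := denom_ratioP (repr c).
move: (frac _).1 (frac _).2 => n m m0 cE.
exists (d * m), (m%:P * P * 'X + (d * n)%:P); split; first by rewrite mulf_neq0.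
rewrite rmorphD !rmorphM /= !map_polyC map_polyX PE scalerDr; congr (_ + _).
  by rewrite mul_polyC scalerA -scalerAl mulrC.
by rewrite -mul_polyC cE -!polyCM -mulrA (mulrC (tofrac m)) divfK ?tofrac_eq0.
Qed.

End Clearing.

Section Bivariate.
Variable k : closedFieldType.
Implicit Types (P Q H : {poly {poly k}}) (c d : {poly k}) (z : k).

Lemma dvd_of_eval_eq0 P z : map_poly (horner_eval z) P = 0 ->
  exists Q, P = ('X - z%:P)%:P * Q.
Proof.
rewrite -horner_swapXY => /eqP; rewrite -/(root _ _) => /factor_theorem[Q PE].
exists (swapXY Q); rewrite -[P]swapXYK PE rmorphM /= mulrC; congr (_ * _).
rewrite (raddfB (@swapXY k)) polyCB; congr (_ - _); first exact: swapXY_X.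
exact: etrans (swapXY_polyC _) (map_polyC _ _).
Qed.

(** Since [k] is algebraically closed, a polynomial in [x] over [k[y]] is
    primitive when it vanishes identically for no value of [y]. *)
Definition primitive P := forall z, map_poly (horner_eval z) P != 0.

(** Gauss's lemma: the constant [c] is removed one root at a time. *)
Lemma gauss_primitive c P Q H : primitive H -> c != 0 -> c%:P * P = Q * H ->
  exists Q', P = Q' * H.
Proof.
move=> primH; have [n] := ubnP (size c).
elim: n c Q => // n IH c Q; rewrite ltnS => cn c0 E.
have [c1|/closed_rootP[z]] := boolP (size c == 1%N).
  move: c1 => /size_poly1P[a a0 ca]; exists (a^-1%:P%:P * Q).
  by rewrite -mulrA -E ca mulrA -!rmorphM mulVf // mul1r.
move=> rz; have [c' cE] := factor_theorem _ _ rz.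
have /eqP : map_poly (horner_eval z) (Q * H) = 0.
  by rewrite -E rmorphM /= map_polyC /= /horner_eval (eqP rz) mul0r.
rewrite rmorphM mulf_eq0 (negPf (primH z)) orbF => /eqP /dvd_of_eval_eq0[Q' QE].
have x0 : ('X - z%:P) != 0 :> {poly k} by rewrite polyXsubC_eq0.
have c'0 : c' != 0 by apply: contraNneq c0 => e; rewrite cE e mul0r.
apply: (IH c' Q') => //.
  by apply: leq_trans cn; rewrite cE size_Mmonic ?monicXsubC // size_XsubC addn2.
have x1 : ('X - z%:P)%:P != 0 :> {poly {poly k}} by rewrite polyC_eq0.
by apply: (mulfI x1); rewrite [RHS]mulrA -QE -E cE rmorphM /= mulrA [_ * c'%:P]mulrC.
Qed.

(** Denominators are cleared, then the factors of the content are removed one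
    at a time, which lowers the degree of the leading coefficient. *)
Lemma primitive_part (p : {poly {fraction {poly k}}}) : p \is monic ->
  exists H, primitive H /\ map_poly (@tofrac _) H = tofrac (lead_coef H) *: p.
Proof.
move=> pm; have [d [P [d0 PE]]] := clear_denominators p.
have {d d0}PE : P != 0 /\ map_poly (@tofrac _) P = tofrac (lead_coef P) *: p.
  have P0 : P != 0.
    apply: contraNneq (mulf_neq0 (_ : (tofrac d)%:P != 0) (monic_neq0 pm)).
      by move=> e; rewrite mul_polyC -PE e rmorph0.
    by rewrite polyC_eq0 tofrac_eq0.
  have -> // : tofrac (lead_coef P) = tofrac d.
  have <- : lead_coef (map_poly (@tofrac _) P) = tofrac (lead_coef P).
    by rewrite lead_coef_map_eq ?tofrac_eq0 ?lead_coef_eq0 ?rmorph0.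
  by rewrite PE lead_coefZ (monicP pm) mulr1.
have [n] := ubnP (size (lead_coef P)).
elim: n P PE => // n IH P [P0 PE]; rewrite ltnS => Pn.
have [pr|] := pselect (primitive P); first by exists P.
move=> /existsNP[z /negP]; rewrite negbK => /eqP /dvd_of_eval_eq0[Q QE].
have x0 : ('X - z%:P) != 0 :> {poly k} by rewrite polyXsubC_eq0.
have Q0 : Q != 0 by apply: contraNneq P0 => e; rewrite QE e mulr0.
have lQ : lead_coef P = ('X - z%:P) * lead_coef Q.
  by rewrite QE lead_coefM lead_coefC.
apply: (IH Q).
  split=> //; have x1 : tofrac ('X - z%:P) != 0 :> {fraction {poly k}} by rewrite tofrac_eq0.
  apply: (scalerI x1).
  by rewrite scalerA -rmorphM -lQ -PE QE rmorphM /= map_polyC mul_polyC.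
apply: leq_trans Pn; rewrite lQ mulrC size_Mmonic ?monicXsubC ?lead_coef_eq0 //.
by rewrite size_XsubC addn2.
Qed.

End Bivariate.

Lemma minimal_polynomial (L K : fieldType) (iota : {rmorphism L -> K}) (x : K) :
  (exists2 p, p != 0 & (map_poly iota p).[x] = 0) ->
  exists h, [/\ h \is monic, (map_poly iota h).[x] = 0
    & forall p, (map_poly iota p).[x] = 0 -> h %| p].
Proof.
move=> [p0 p00 p0x].
pose S n := `[< exists p, [/\ p != 0, (map_poly iota p).[x] = 0 & size p = n] >].
have Sex : exists n, S n by exists (size p0); apply/asboolP; exists p0.
case: (ex_minnP Sex) => n /asboolP[h [h0 hx hn]] nmin.
have lh : lead_coef h != 0 by rewrite lead_coef_eq0.
exists ((lead_coef h)^-1 *: h); split.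
- by rewrite monicE lead_coefZ mulVf.
- by rewrite map_polyZ hornerZ hx mulr0.
move=> p px; rewrite dvdpZl ?invr_eq0 //.
apply/negPn/negP => ndvd; have /nmin : S (size (p %% h)).
  apply/asboolP; exists (p %% h); split=> //.
  have : (map_poly iota p).[x] = 0 by [].
  by rewrite {1}(divp_eq p h) rmorphD rmorphM /= hornerD hornerM hx mulr0 add0r.
by rewrite -hn leqNgt ltn_modp h0.
Qed.

(** * Fibre polynomials *)

Section Fibre.
Context {R : realType}.
Implicit Types (F G H D : ratfun R).

(** The polynomial [P(x) - G Q(x)], where [F = P / Q]: its roots are the
    solutions [x] of [F(x) = G].  The coefficient [G] is a rational function. *)
Definition fibre_poly F G : {poly ratfun R} := (numer F)^E - G *: (denom F)^E.

Lemma fibre_poly_root F G D : nonconstant D ->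
  (fibre_poly F G).[D] = 0 <-> F \oR D = G.
Proof.
move=> D0; rewrite /fibre_poly hornerD hornerN hornerZ /ratcomp.
have q0 := horner_ratC_neq0 D0 (denom_neq0 F).
split=> [/eqP|<-]; last by rewrite divfK // subrr.
by rewrite subr_eq0 => /eqP ->; rewrite mulfK.
Qed.

Lemma size_fibre_poly F G : nonconstant F -> nonconstant G ->
  size (fibre_poly F G) = (degree F).+1.
Proof.
move=> F0 G0.
have sF : maxn (size (numer F)) (size (denom F)) = (degree F).+1.
  by move: F0; rewrite /nonconstant /degree; case: maxn.
have [sP sQ] : (size (numer F) <= (degree F).+1)%N /\ (size (denom F) <= (degree F).+1)%N.
  by rewrite -sF leq_maxl leq_maxr.
set n := degree F in sF sP sQ *.
apply/eqP; rewrite eqn_leq; apply/andP; split.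
  rewrite (leq_trans (size_polyD _ _)) // size_polyN geq_max size_map_poly sP.
  by rewrite (leq_trans (size_scale_leq _ _)) // size_map_poly.
rewrite ltnNge; apply/negP => /leq_sizeP/(_ _ (leqnn _)).
rewrite /fibre_poly coefB coefZ !coef_map /= => /eqP; rewrite subr_eq0 => /eqP E.
have [q0|q0] := eqVneq ((denom F)`_n) 0.
  move: E; rewrite q0 polyC0 tofrac0 mulr0 => /eqP; rewrite tofrac_eq0 polyC_eq0 => /eqP p0.
  suff : (maxn (size (numer F)) (size (denom F)) <= n)%N by rewrite sF ltnn.
  rewrite geq_max; apply/andP; split; apply/leq_sizeP => j.
    by rewrite leq_eqVlt => /orP[/eqP<-//|nj]; rewrite nth_default // (leq_trans sP).
  by rewrite leq_eqVlt => /orP[/eqP<-//|nj]; rewrite nth_default // (leq_trans sQ).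
move/nonconstantP: G0 => /(_ ((numer F)`_n / (denom F)`_n)); apply.
rewrite [RHS](fmorph_div (@tofrac _ \o polyC)) /= E mulfK //.
by rewrite tofrac_eq0 polyC_eq0.
Qed.

Lemma fibre_poly_neq0 F G : nonconstant F -> nonconstant G -> fibre_poly F G != 0.
Proof. by move=> F0 G0; rewrite -size_poly_gt0 size_fibre_poly. Qed.

Lemma rcomp_fibre_poly F G D (D0 : nonconstant D) :
  map_poly (rcomp D0) (fibre_poly F G) = fibre_poly F (G \oR D).
Proof.
have mc (p : {poly R[i]}) : map_poly (rcomp D0) p^E = p^E.
  by rewrite -map_poly_comp; apply: eq_map_poly => c /=; exact: ratcomp_ratC.
by rewrite rmorphB /= map_polyZ !mc.
Qed.

Lemma coprimep_ratC p q : coprimep p q -> coprimep (p^E : {poly ratfun R}) q^E.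
Proof. by rewrite coprimep_map. Qed.

End Fibre.

(** A subfield of the field of rational functions is given as an abstract field
    [L] with an embedding [iota]. *)
Section Luroth.
Context {R : realType}.
Variables (L : fieldType) (iota : {rmorphism L -> ratfun R}).
Hypothesis iota_ratC : forall c, exists l, iota l = ratC c.

Lemma lift_ratC : exists lift : {poly R[i]} -> {poly L},
  forall p, map_poly iota (lift p) = p^E.
Proof.
have [kap kapE] := choice iota_ratC.
have k0 : kap 0 = 0 by apply: (fmorph_inj iota); rewrite kapE !rmorph0.
exists (map_poly kap) => p; apply/polyP => i.
by rewrite !coef_map /= coef_map_id0 // kapE.
Qed.

Lemma lift_fibre_poly F l : exists p, map_poly iota p = fibre_poly F (iota l).
Proof.
have [lift liftE] := lift_ratC.
by exists (lift (numer F) - l *: lift (denom F)); rewrite rmorphB /= map_polyZ !liftE.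
Qed.

(** The image of [iota] is closed under [F o _]. *)
Lemma image_ratcomp F l : nonconstant (iota l) -> exists l', iota l' = F \oR iota l.
Proof.
have [lift liftE] := lift_ratC => l0.
exists ((lift (numer F)).[l] / (lift (denom F)).[l]).
by rewrite fmorph_div /= -!horner_map /= !liftE.
Qed.

Variable l0 : L.
Hypothesis l0_nonconstant : nonconstant (iota l0).

Lemma minimal_polynomial_ratX : exists h, [/\ h \is monic,
  (map_poly iota h).[ratX] = 0 & forall p, (map_poly iota p).[ratX] = 0 -> h %| p].
Proof.
apply: minimal_polynomial; have [p pE] := lift_fibre_poly (iota l0) l0.
exists p; last by rewrite pE; apply/fibre_poly_root; rewrite ?ratcompX.
by rewrite -(map_poly_eq0 iota) pE fibre_poly_neq0.
Qed.

(** Otherwise [ratX] would be algebraic over the constants. *)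
Lemma nonconstant_coef (h : {poly L}) : h != 0 -> (map_poly iota h).[ratX] = 0 ->
  exists j, nonconstant (iota h`_j).
Proof.
move=> h0 hX; apply/not_existsP => hc.
have hc' j : exists c, iota h`_j = ratC c.
  by apply/not_existsP => cc; apply: (hc j); apply/nonconstantP => c; apply: cc.
have [c cE] := choice hc'.
pose r := \poly_(j < size h) c j.
have rE : map_poly iota h = r^E.
  apply/polyP => j; rewrite !coef_map coef_poly.
  case: ssrnat.ltnP => [_|hj]; first exact: cE.
  by rewrite nth_default //= !rmorph0.
have r0 : r != 0 by rewrite -(map_poly_eq0 (@tofrac _ \o polyC)) -rE map_poly_eq0.
by have := horner_ratC_neq0 (@nonconstant_ratX R) r0; rewrite -rE hX eqxx.
Qed.

End Luroth.

(** * Numerators of fibre polynomials *)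

Lemma clear_identity (K : comNzRingType) (b c d : K) (q h : {poly K}) :
  c%:P * d%:P * (b *: (q * h)) = b%:P * (c *: q) * (d *: h).
Proof. by rewrite -!mul_polyC; ring. Qed.

Section Cross.
Context {R : realType}.
Implicit Types F G : ratfun R.

(** The numerator of [F(x) - G(y)], as a polynomial in [x] over [k[y]], where
    [k] is the field of complex numbers. *)
Definition cross_poly F G : {poly {poly R[i]}} :=
  map_poly polyC (numer F) * (denom G)%:P - map_poly polyC (denom F) * (numer G)%:P.

Lemma map_cross_poly F G :
  map_poly (@tofrac _) (cross_poly F G) = tofrac (denom G) *: fibre_poly F G.
Proof.
have bG : tofrac (denom G) * G = tofrac (numer G).
  by rewrite {2}[G]numer_denomE mulrC divfK // tofrac_eq0 denom_neq0.
rewrite /cross_poly rmorphB !rmorphM /= !map_polyC /= -!map_poly_comp.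
rewrite /fibre_poly scalerBr scalerA bG.
by rewrite -!mul_polyC [_ * (tofrac (denom G))%:P]mulrC [_ * (tofrac (numer G))%:P]mulrC.
Qed.

Lemma horner_cross_poly F G x y : (cross_poly F G).[x, y] =
  (numer F).[x] * (denom G).[y] - (denom F).[x] * (numer G).[y].
Proof.
by rewrite /cross_poly hornerD hornerN !hornerM !horner_map !hornerC /= !(hornerD, hornerN, hornerM, hornerC).
Qed.

Lemma horner_deriv_cross_poly F G x y : (cross_poly F G)^`().[x, y] =
  (numer F)^`().[x] * (denom G).[y] - (denom F)^`().[x] * (numer G).[y].
Proof.
rewrite /cross_poly derivB !derivM !derivC !mulr0 !addr0 !deriv_map.
by rewrite hornerD hornerN !hornerM !horner_map !hornerC /= !(hornerD, hornerN, hornerM, hornerC).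
Qed.

End Cross.

Lemma leq1_of_pred_add s t n :
  (s + t).-1 = n.+1 -> (n < t)%N -> (s <= 1)%N.
Proof.
case: s => [|[|s]] //=; rewrite addSn => -[<-].
by rewrite ltnNge leq_addl.
Qed.

Section SelfFibre.
Context {R : realType}.
Variable G : ratfun R.
Hypothesis G0 : nonconstant G.
Local Notation a := (numer G).
Local Notation b := (denom G).

Local Notation self_fibre := (cross_poly G G).

Lemma size_self_fibre : size self_fibre = (degree G).+1.
Proof.
have b0 : tofrac b != 0 :> ratfun R by rewrite tofrac_eq0 denom_neq0.
rewrite -(size_fibre_poly G0 G0) -(size_scale _ b0) -map_cross_poly.
by rewrite size_map_inj_poly ?rmorph0 // => x y /eqP; rewrite tofrac_eq => /eqP.
Qed.

Lemma swap_self_fibre : swapXY self_fibre = - self_fibre.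
Proof.
have swapM (p q : {poly R[i]}) :
    swapXY (map_poly polyC p * q%:P) = map_poly polyC q * p%:P.
  by rewrite rmorphM /= swapXY_polyC swapXY_map_polyC mulrC.
rewrite /cross_poly opprB; apply: etrans (raddfB (@swapXY _) _ _) _.
by congr (_ - _); exact: swapM.
Qed.

(** No polynomial in [x] alone divides [P(x) Q(y) - P(y) Q(x)]. *)
Lemma self_fibre_primitive (r : {poly R[i]}) H :
  self_fibre = map_poly polyC r * H -> size r = 1%N.
Proof.
move=> E; apply/eqP/negPn/negP => /closed_rootP[x rx].
have : self_fibre.[x%:P] = 0.
  by rewrite E hornerM horner_map (eqP rx) mul0r.
rewrite /cross_poly hornerD hornerN !hornerM !horner_map !hornerC /= => /eqP.
rewrite subr_eq0 => /eqP ab.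
have [bx|bx] := eqVneq b.[x] 0.
  have ax : a.[x] != 0.
    have := coprime_numer_denom G; rewrite coprimep_sym => /coprimep_root; apply.
    exact/eqP.
  move: ab; rewrite bx mul0r => /eqP; rewrite mulf_eq0 (negPf (denom_neq0 G)).
  by rewrite orbF polyC_eq0 (negPf ax).
move/nonconstantP: G0 => /(_ (a.[x] / b.[x])); apply.
rewrite [RHS](fmorph_div (@tofrac _ \o polyC)) /= {1}[G]numer_denomE.
apply/eqP; rewrite eqr_div ?tofrac_eq0 ?denom_neq0 ?polyC_eq0 //.
by rewrite -!rmorphM /= ab mulrC.
Qed.

(** The bidegree count behind Lueroth's theorem: [h] has degree at least
    [degree G] in [y], because [G] is one of its coefficients, so the cofactor
    of [h] in [P(x) Q(y) - P(y) Q(x)] does not involve [y]. *)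
Lemma size_divisor_fibre_poly (h : {poly ratfun R}) j :
  h \is monic -> h`_j = G -> h %| fibre_poly G G -> size h = (degree G).+1.
Proof.
move=> hm hj /dvdpP[q qE].
have [H [Hp HE]] := primitive_part hm.
have d0 : lead_coef H != 0.
  rewrite lead_coef_eq0; apply: contraTneq (Hp 0) => ->.
  by rewrite rmorph0 eqxx.
have bG : b != 0 := denom_neq0 G.
set d := lead_coef H in HE d0.
have Hj : H`_j * b = a * d.
  apply: eq_frac => //.
  have : (map_poly (@tofrac _) H)`_j = tofrac d * G by rewrite HE coefZ hj.
  rewrite coef_map /= => ->; rewrite mulrC mulKf ?tofrac_eq0 //.
  exact: numer_denomE.
have cab := coprime_numer_denom G.
have bd : b %| d.
  by rewrite coprimep_sym in cab; rewrite -(Gauss_dvdpr _ cab) -Hj dvdp_mull.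
have aH : a %| H`_j by rewrite -(Gauss_dvdpl _ cab) Hj dvdp_mulr.
have a0 : a != 0.
  apply/eqP => a0; move/nonconstantP: G0 => /(_ 0); apply.
  by rewrite {1}[G]numer_denomE a0 /= polyC0 rmorph0 mul0r.
have Hj0 : H`_j != 0.
  by apply: contraNneq (mulf_neq0 a0 d0) => e; rewrite -Hj e mul0r.
have degH : ((degree G).+1 <= sizeY H)%N.
  have -> : (degree G).+1 = maxn (size a) (size b).
    by move: G0; rewrite /nonconstant /degree; case: maxn.
  rewrite geq_max; apply/andP; split.
    exact: leq_trans (dvdp_leq Hj0 aH) (max_size_coefXY _ _).
  exact: leq_trans (dvdp_leq d0 bd) (max_size_lead_coefXY _).
have [c [Q0 [c0 Q0E]]] := clear_denominators q.
have [Q QE] : exists Q, self_fibre = Q * H.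
  apply: (@gauss_primitive _ (c * d) _ (b%:P * Q0)) => //.
    by rewrite mulf_neq0.
  apply: map_tofrac_inj; rewrite !rmorphM /= map_cross_poly !map_polyC /= HE Q0E qE.
  exact: clear_identity.
have F0 : self_fibre != 0 by rewrite -size_poly_gt0 size_self_fibre.
have [Q_0 H_0] : Q != 0 /\ H != 0.
  by apply/andP; rewrite -negb_or -mulf_eq0 -QE.
have := size_self_fibre; rewrite -size_polyN -swap_self_fibre QE rmorphM /=.
rewrite size_mul ?swapXY_eq0 // -(sizeYE H) => sz.
have /size_poly1P[r r0 rE] : size (swapXY Q) == 1%N.
  have : (0 < size (swapXY Q))%N by rewrite size_poly_gt0 swapXY_eq0.
  by rewrite eqn_leq => ->; rewrite andbT (leq1_of_pred_add sz degH).
have {}rE : Q = map_poly polyC r by rewrite -swapXY_polyC -rE swapXYK.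
have r1 : size r = 1%N by apply: (@self_fibre_primitive r H); rewrite -rE.
have Q1 : size Q = 1%N by rewrite rE size_map_polyC.
have := size_self_fibre; rewrite QE size_mul // Q1 /= => <-.
have : size (map_poly (@tofrac _) H) = size H.
  by rewrite size_map_inj_poly ?rmorph0 // => x y /eqP; rewrite tofrac_eq => /eqP.
by rewrite HE size_scale ?tofrac_eq0.
Qed.

End SelfFibre.

(** * Lueroth's theorem *)

Lemma division_identity (K : comNzRingType) (D : K) (q1 q2 r1 r2 p : {poly K}) :
  r1 - D *: r2 = q1 * p + r1 - D *: (q2 * p + r2) - (q1 - D *: q2) * p.
Proof. by rewrite -!mul_polyC; ring. Qed.

Section LurothTheorem.
Context {R : realType}.
Implicit Types (F G D : ratfun R).

(** [D] is determined by [G] if every solution [x] of [G(x) = G] also solves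
    [D(x) = D], with multiplicities. *)
Lemma fibre_poly_dvd_factor D G : nonconstant D -> nonconstant G ->
  fibre_poly G G %| fibre_poly D D -> exists f, D = f \oR G.
Proof.
move=> D0 G0 dvd.
pose phi := rcomp G0; pose psi := fibre_poly G (ratX : ratfun R).
have psiE : map_poly phi psi = fibre_poly G G.
  by rewrite /psi rcomp_fibre_poly ratXcomp.
have psi0 : psi != 0 by exact: fibre_poly_neq0.
pose P : {poly ratfun R} := (numer D)^E; pose Q : {poly ratfun R} := (denom D)^E.
have mc (p : {poly R[i]}) : map_poly phi p^E = p^E.
  by rewrite -map_poly_comp; apply: eq_map_poly => c /=; exact: ratcomp_ratC.
(* Composition with [G] maps [psi] to the polynomial of [G] and fixes [P] and
   [Q], so the remainders of [P] and [Q] by [psi] are mapped to polynomials with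
   ratio [D], as [P - D Q] is divisible by the polynomial of [G]. *)
have rE : map_poly phi (P %% psi) = D *: map_poly phi (Q %% psi).
  apply/eqP; rewrite -subr_eq0 -size_poly_eq0; apply/negPn/negP => rn0.
  have : fibre_poly G G %| map_poly phi (P %% psi) - D *: map_poly phi (Q %% psi).
    have -> : map_poly phi (P %% psi) - D *: map_poly phi (Q %% psi) =
        fibre_poly D D - (map_poly phi (P %/ psi) - D *: map_poly phi (Q %/ psi))
          * fibre_poly G G.
      have EP : map_poly phi (P %/ psi) * fibre_poly G G + map_poly phi (P %% psi)
                 = (numer D)^E.
        rewrite -psiE -rmorphM -rmorphD -divp_eq; exact: mc.
      have EQ : map_poly phi (Q %/ psi) * fibre_poly G G + map_poly phi (Q %% psi)
                 = (denom D)^E.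
        rewrite -psiE -rmorphM -rmorphD -divp_eq; exact: mc.
      rewrite [fibre_poly D D]/fibre_poly -EP -EQ.
      exact: division_identity.
    by rewrite dvdp_sub // dvdp_mull.
  move/dvdp_leq; rewrite -size_poly_eq0 => /(_ rn0); apply/negP; rewrite -ltnNge.
  apply: leq_ltn_trans (size_polyD _ _) _.
  rewrite size_polyN gtn_max -psiE; apply/andP; split.
    by rewrite !size_map_poly ltn_modp.
  apply: leq_ltn_trans (size_scale_leq _ _) _.
  by rewrite !size_map_poly ltn_modp.
have r0 : Q %% psi != 0.
  apply/eqP => q0; move: rE; rewrite q0 rmorph0 scaler0 => /eqP.
  rewrite map_poly_eq0 => p0.
  have : psi %| gcdp P Q by rewrite dvdp_gcd /dvdp p0 q0 eqxx.
  have /eqP : coprimep P Q by apply: coprimep_ratC; exact: coprime_numer_denom.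
  move=> g1 /dvdp_leq; rewrite -size_poly_gt0 g1 => /(_ isT).
  by rewrite size_fibre_poly // ltnS leqNgt G0.
have l0 : lead_coef (Q %% psi) != 0 by rewrite lead_coef_eq0.
set i := (size (Q %% psi)).-1.
exists ((P %% psi)`_i / (Q %% psi)`_i).
have := congr1 (fun p : {poly ratfun R} => p`_i) rE.
rewrite coefZ !coef_map /= => E.
have b0 : rcomp G0 (Q %% psi)`_i != 0 by rewrite (fmorph_eq0 (rcomp G0)).
rewrite -[RHS]/(rcomp G0 _) (fmorph_div (rcomp G0)).
exact: (canRL (mulfK b0) (esym E)).
Qed.

(** Lueroth's theorem: a subfield of the field of rational functions which
    contains the constants, and a nonconstant function, consists of the
    functions of one of its elements. *)
Theorem luroth (L : fieldType) (iota : {rmorphism L -> ratfun R}) (l0 : L) :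
  (forall c, exists l, iota l = ratC c) -> nonconstant (iota l0) ->
  exists g, nonconstant (iota g) /\ forall l, exists f, iota l = f \oR iota g.
Proof.
move=> iotaC l00.
have [h [hm hX hmin]] := minimal_polynomial_ratX iotaC l00.
have [j G0] := nonconstant_coef (monic_neq0 hm) hX.
set G := iota h`_j in G0.
pose hK := map_poly iota h.
have dvd l : nonconstant (iota l) -> hK %| fibre_poly (iota l) (iota l).
  move=> D0; have [p pE] := lift_fibre_poly iotaC (iota l) l.
  rewrite -pE dvdp_map; apply: hmin; rewrite pE.
  by apply/fibre_poly_root; rewrite ?ratcompX.
have sz : size hK = (degree G).+1.
  apply: (@size_divisor_fibre_poly _ _ G0 _ j); last exact: dvd.
    by rewrite monic_map.
  by rewrite coef_map.
have eqG : hK %= fibre_poly G G.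
  by rewrite -dvdp_size_eqp ?dvd // sz size_fibre_poly.
exists h`_j; split=> // l.
have [D0|/nonconstantP] := pselect (nonconstant (iota l)).
  by apply: fibre_poly_dvd_factor => //; rewrite -(eqp_dvdl _ eqG) dvd.
move=> /existsNP[c /contrapT cE]; exists (ratC c).
by rewrite cE ratcomp_ratC.
Qed.

End LurothTheorem.

(** * Paths on the sphere *)

Section Topology.
Local Open Scope classical_set_scope.
Local Open Scope ring_scope.
Context {R : realType}.

(** Continuity on the unit interval of a function defined on [R]. *)
Definition cont01 {T : topologicalType} (u : R -> T) : Prop :=
  forall t : R, (`[0, 1]%classic : set R) t -> u x @[x --> within `[0, 1] (nbhs t)] --> u t.

(** The unit interval is connected: if the zero sets of [u] and [v] cover it
    and are disjoint, one of them is the whole interval. *)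
Lemma connected_zero (u v : R -> R[i]^o) : cont01 u -> cont01 v ->
  (forall t, (`[0, 1]%classic : set R) t -> u t = 0 \/ v t = 0) ->
  (forall t, (`[0, 1]%classic : set R) t -> u t = 0 -> v t = 0 -> False) ->
  u 0 = 0 -> v 1 = 0 -> False.
Proof.
move=> cu cv uv nuv u0 v1.
have nclosure (w w' : R -> R[i]^o) : cont01 w ->
    (forall t, (`[0, 1]%classic : set R) t -> w t = 0 -> w' t = 0 -> False) ->
    [set t | (`[0, 1]%classic : set R) t /\ w' t = 0] `&` closure [set t | (`[0, 1]%classic : set R) t /\ w t = 0]
      = set0.
  move=> cw nww'; rewrite -subset0 => t [[/= tI wt']] clt.
  have wt : w t != 0 by apply/eqP => wt; apply: (nww' t).
  have : nbhs (w t) [set z | z != 0].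
    apply: open_nbhs_nbhs; split=> //.
    rewrite [X in open X](_ : _ = ~` [set (0 : R[i]^o)]).
      apply: closed_openC; apply: accessible_closed_set1.
      by apply: hausdorff_accessible; exact: norm_hausdorff.
    by apply/seteqP; split=> z /= /eqP.
  move=> /(cw _ tI); rewrite /= nbhs_simpl /= => wn0.
  have [s [[/= sI ws0] /(_ sI)]] := clt _ wn0.
  by rewrite /= ws0 eqxx.
have /connectedP := @segment_connected R 0 1.
have I0 : `[0, 1]%classic (0 : R) by rewrite /= in_itv /= lexx ler01.
have I1 : `[0, 1]%classic (1 : R) by rewrite /= in_itv /= lexx ler01.
move=> /(_ (fun b => [set t | (`[0, 1]%classic : set R) t /\ (if b then u else v) t = 0])); apply.
split.
- by case; [exists 0 | exists 1].
- apply/seteqP; split=> [t tI|t [[]|[]]//].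
  by have [?|?] := uv t tI; [right|left].
split; last exact: nclosure.
rewrite setIC; apply: nclosure => // t tI vt ut; exact: (nuv t).
Qed.

Lemma cont01_horner (p : {poly R[i]}) (u : R -> R[i]^o) :
  cont01 u -> cont01 (fun t => p.[u t] : R[i]^o).
Proof.
move=> cu t tI; elim/poly_ind: p => [|p c IH].
  by under eq_fun do rewrite horner0; rewrite horner0; exact: cvg_cst.
under eq_fun do rewrite hornerMXaddC; rewrite hornerMXaddC.
apply: cvgD; last exact: cvg_cst.
apply: cvgM IH _; exact: cu.
Qed.

Lemma cont01_horner2 (P : {poly {poly R[i]}}) (u v : R -> R[i]^o) :
  cont01 u -> cont01 v -> cont01 (fun t => P.[u t, v t] : R[i]^o).
Proof.
move=> cu cv t tI; elim/poly_ind: P => [|P c IH].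
  by under eq_fun do rewrite !horner0; rewrite !horner0; exact: cvg_cst.
have E z w : (P * 'X + c%:P).[z, w] = P.[z, w] * z + c.[w].
  by rewrite hornerMXaddC hornerD hornerM hornerC.
under eq_fun do rewrite E; rewrite E.
apply: cvgD; last exact: cont01_horner.
apply: cvgM IH _; exact: cu.
Qed.

(** The affine coordinate of a point of the sphere; it is 0 at infinity. *)
Definition affine (p : P1 R) : R[i]^o := odflt 0 p.

Lemma affine_continuous (z : R[i]) :
  affine p @[p --> (Some z : P1 R)] --> (z : R[i]^o).
Proof. by move=> U Uz; rewrite /= nbhs_simpl. Qed.

Lemma cont01_affine (h : R -> P1 R) :
  {within `[0, 1], continuous h} -> (forall t, t \in `[0, 1] -> h t <> None) ->
  cont01 (affine \o h).
Proof.
move=> /subspace_continuousP ch hN t tI.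
have cht : h x @[x --> within `[0, 1] (nbhs t)] --> h t by exact: ch.
case E : (h t) cht (hN t tI) => [z|//] cht _; rewrite /= E /=.
exact: cvg_comp cht (@affine_continuous z).
Qed.

End Topology.

(** * Irreducibility of fibre products *)

Section FiniteSets.
Local Open Scope classical_set_scope.
Local Open Scope ring_scope.

Lemma finite_roots (k : closedFieldType) (p : {poly k}) : p != 0 ->
  finite_set [set z | p.[z] = 0].
Proof.
move=> p0; have [r pE] := closed_field_poly_normal p.
apply: (@sub_finite_set _ _ [set` r]); last exact: finite_seq.
move=> z /= /eqP; rewrite pE hornerZ mulf_eq0 lead_coef_eq0 (negPf p0) /=.
by rewrite -/(root _ _) root_prod_XsubC.
Qed.

Lemma finite_set_avoid (K : numDomainType) (A : set K) : finite_set A ->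
  exists z, ~ A z.
Proof.
move=> /finite_seqP[s ->]; apply/not_existsP => As.
pose l := [seq (n%:R : K) | n <- iota 0 (size s).+1].
have ul : uniq l by rewrite map_inj_uniq ?iota_uniq //; exact: mulrIn (oner_neq0 _).
have : (size l <= size s)%N.
  by apply: uniq_leq_size => // z _; apply: contrapT => zs; apply: (As z).
by rewrite size_map size_iota ltnn.
Qed.

End FiniteSets.

Lemma deriv_eq0_size (K : numDomainType) (p : {poly K}) : p^`() = 0 -> (size p <= 1)%N.
Proof.
move=> p'0; apply/leq_sizeP => -[//|j] _.
have : p^`()`_j = 0 by rewrite p'0 coef0.
by rewrite coef_deriv => /eqP; rewrite mulrn_eq0 /= => /eqP.
Qed.

Section Critical.
Local Open Scope classical_set_scope.
Local Open Scope ring_scope.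
Context {R : realType}.
Implicit Types (F G : ratfun R).

Lemma wronskian_poly_neq0 F : nonconstant F ->
  (numer F)^`() * denom F - numer F * (denom F)^`() != 0.
Proof.
move=> F0; apply/eqP => /eqP; rewrite subr_eq0 => /eqP E.
have cpq := coprime_numer_denom F.
have small (p q : {poly R[i]}) : coprimep p q -> p^`() * q = p * q^`() -> (size p <= 1)%N.
  move=> cp e; apply: deriv_eq0_size; apply/eqP/negPn/negP => p'0.
  have : p %| p^`() by rewrite -(Gauss_dvdpl _ cp) e dvdp_mulr.
  have p0 : p != 0 by apply: contraNneq p'0 => ->; rewrite deriv0.
  by move/(dvdp_leq p'0); rewrite leqNgt lt_size_deriv.
move: F0; rewrite /nonconstant /degree lt0n => /negP; apply.
have sp := small _ _ cpq E.
have sq : (size (denom F) <= 1)%N.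
  by apply: (small _ (numer F)); rewrite 1?coprimep_sym // mulrC -E mulrC.
by have : (maxn (size (numer F)) (size (denom F)) <= 1)%N; [rewrite geq_max sp | case: maxn => [|[]]].
Qed.

Lemma finite_critical_value F : nonconstant F -> finite_set (critical_value F).
Proof.
move=> F0; rewrite /critical_value; apply: finite_image.
apply: (@sub_finite_set _ _ ([set None] `|` Some @`
   [set z | ((numer F)^`() * denom F - numer F * (denom F)^`()).[z] = 0])).
  move=> [z|] /=; last by left.
  by rewrite /wronskian => Fz; right; exists z => //=; rewrite !hornerE.
rewrite finite_setU; split; first exact: finite_set1.
by apply: finite_image; apply: finite_roots; exact: wronskian_poly_neq0.
Qed.

Lemma rateval_SomeP F z w :
  rateval F (Some z) = Some w <-> (denom F).[z] != 0 /\ (numer F).[z] = w * (denom F).[z].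
Proof.
rewrite /= /rateval_fin; have [q0|q0] := eqVneq; first by split => // -[].
split=> [[<-]|[_ ->]]; first by rewrite divfK.
by rewrite mulfK.
Qed.

Lemma finite_fibre F p : nonconstant F -> finite_set [set z | rateval F (Some z) = p].
Proof.
move=> F0; case: p => [w|]; last first.
  apply: sub_finite_set (finite_roots (denom_neq0 F)) => z /=.
  by rewrite /rateval_fin; case: eqP.
have p0 : numer F - w *: denom F != 0.
  rewrite subr_eq0; apply/eqP => E; move/nonconstantP: F0 => /(_ w); apply.
  rewrite [LHS]numer_denomE E -mul_polyC rmorphM /= mulfK //.
  by rewrite tofrac_eq0 denom_neq0.
apply: sub_finite_set (finite_roots p0) => z /= /rateval_SomeP[_ E].
by rewrite hornerD hornerN hornerZ E subrr.
Qed.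

Lemma finite_preimage F (S : set (P1 R)) : nonconstant F -> finite_set S ->
  finite_set [set z | S (rateval F (Some z))].
Proof.
move=> F0 Sf.
have -> : [set z | S (rateval F (Some z))] =
    \bigcup_(p in S) [set z | rateval F (Some z) = p].
  apply/seteqP; split=> [z Sz|z [p Sp /= E]]; last by rewrite /= E.
  by exists (rateval F (Some z)).
by apply: bigcup_finite => // p _; exact: finite_fibre.
Qed.

(** If the fibre product of [A] and [B] is irreducible, the polynomial
    [A1(x) - B(y) A2(x)], where [A = A1 / A2], is irreducible over [k(y)].  If it
    were a product, the points of the fibre product where the first factor
    vanishes would be separated from those where the second one vanishes, away
    from the critical values of [A]; so no loop would carry the former to the
    latter. *)
Theorem fibre_poly_irreducible A B (f g : {poly ratfun R}) :
  nonconstant A -> nonconstant B -> ~ reducible_pair A B ->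
  fibre_poly A B = f * g -> (1 < size f)%N -> (1 < size g)%N -> False.
Proof.
move=> A0 B0 nred E sf sg.
(* [P] and [Q] are the two factors with denominators cleared. *)
have [d1 [P [d10 PE]]] := clear_denominators f.
have [d2 [Q [d20 QE]]] := clear_denominators g.
have dE : (d1 * d2)%:P * cross_poly A B = (denom B)%:P * P * Q.
  apply: map_tofrac_inj; rewrite !rmorphM /= map_cross_poly !map_polyC /= PE QE E.
  exact: clear_identity.
have szP : size P = size f.
  have -> : size P = size (map_poly (@tofrac _) P).
    by rewrite size_map_inj_poly ?rmorph0 // => x y /eqP; rewrite tofrac_eq => /eqP.
  by rewrite PE size_scale ?tofrac_eq0.
have szQ : size Q = size g.
  have -> : size Q = size (map_poly (@tofrac _) Q).
    by rewrite size_map_inj_poly ?rmorph0 // => x y /eqP; rewrite tofrac_eq => /eqP.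
  by rewrite QE size_scale ?tofrac_eq0.
have P0 : P != 0 by rewrite -size_poly_gt0 szP ltnW.
have Q0 : Q != 0 by rewrite -size_poly_gt0 szQ ltnW.
(* The values of [y] where a denominator or a leading coefficient vanishes. *)
pose N := d1 * d2 * denom B * (lead_coef P * lead_coef Q).
have N0 : N != 0 by rewrite !mulf_neq0 ?lead_coef_eq0 ?denom_neq0.
(* Adding the values at infinity to [S] keeps the lifted paths in the plane. *)
pose S := critical_value A `|` critical_value B `|`
  ([set rateval A None] `|` [set rateval B None]) `|`
  (fun y => rateval B (Some y)) @` [set y | N.[y] = 0].
have Sf : finite_set S.
  rewrite !finite_setU; split; first split.
  - by split; exact: finite_critical_value.
  - by split; exact: finite_set1.
  by apply: finite_image; exact: finite_roots.
have [y0 y0S] := finite_set_avoid (finite_preimage B0 Sf).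
have NS y : ~ S (rateval B (Some y)) -> [/\ d1.[y] != 0, d2.[y] != 0, (denom B).[y] != 0,
    (lead_coef P).[y] != 0 & (lead_coef Q).[y] != 0].
  move=> yS; have : N.[y] != 0.
    by apply/eqP => Ny; apply: yS; right; exists y.
  rewrite /N !hornerM !mulf_eq0 !negb_or => /andP[/andP[/andP[-> ->] ->]].
  by case/andP=> -> ->.
have [d1y d2y By Py Qy] := NS y0 y0S.
have root_at (T : {poly {poly R[i]}}) : (lead_coef T).[y0] != 0 -> (1 < size T)%N ->
    exists x, T.[x, y0] = 0.
  move=> ly sT; have sz : size (map_poly (horner_eval y0) T) = size T.
    by rewrite size_map_poly_id0.
  have /closed_rootP[x] : size (map_poly (horner_eval y0) T) != 1%N.
    by rewrite sz neq_ltn sT orbT.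
  rewrite /root -{1}(hornerC x y0) horner_map /= => /eqP xr.
  by exists x.
have [x0 Px0] : exists x, P.[x, y0] = 0 by apply: root_at; rewrite ?szP.
have [x1 Qx1] : exists x, Q.[x, y0] = 0 by apply: root_at; rewrite ?szQ.
have dEh x y : (d1.[y] * d2.[y]) * (cross_poly A B).[x, y] =
    (denom B).[y] * (P.[x, y] * Q.[x, y]).
  by have := congr1 (fun T : {poly {poly R[i]}} => T.[x, y]) dE;
    rewrite !(hornerM, hornerC) mulrA.
have BvalE y : (denom B).[y] != 0 ->
    rateval B (Some y) = Some ((numer B).[y] / (denom B).[y]).
  by move=> h; rewrite /= /rateval_fin (negPf h).
have AB x y : (denom B).[y] != 0 ->
    (rateval A (Some x) = rateval B (Some y) <-> (cross_poly A B).[x, y] = 0).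
  move=> b0; rewrite BvalE // rateval_SomeP horner_cross_poly; split.
    by case=> a0 ->; field.
  move=> /eqP; rewrite subr_eq0 => /eqP e.
  have a0 : (denom A).[x] != 0.
    apply/eqP => a0; have : (numer A).[x] != 0.
      have := coprime_numer_denom A; rewrite coprimep_sym => /coprimep_root; apply.
      exact/eqP.
    move: e; rewrite a0 mul0r => /eqP; rewrite mulf_eq0 (negPf b0) orbF => /eqP ->.
    by rewrite eqxx.
  by split=> //; apply: (mulIf b0); rewrite e; field.
have fib x T : T.[x, y0] = 0 -> T = P \/ T = Q -> rateval A (Some x) = rateval B (Some y0).
  move=> Tx TPQ; apply/AB => //.
  have : d1.[y0] * d2.[y0] * (cross_poly A B).[x, y0] = 0.
    by rewrite dEh; case: TPQ Tx => -> ->; rewrite ?(mul0r, mulr0).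
  by move=> /eqP; rewrite !mulf_eq0 (negPf d1y) (negPf d2y) /= => /eqP.
have trans : diagonal_transitive A B S (rateval B (Some y0)).
  apply: contrapT => ntr; apply: nred; exists S, (rateval B (Some y0)); split=> //.
    by move=> p Ap; left; left; left.
  by move=> p Bp; left; left; right.
have [gam [[[_ _ _] gamS] [hA [cA hA0 hA1] hAE] [hB [cB hB0 hB1] hBE]]] :=
  trans _ _ _ _ (fib x0 P Px0 (or_introl erefl)) (fib x1 Q Qx1 (or_intror erefl))
    (erefl (rateval B (Some y0))) (erefl (rateval B (Some y0))).
have hAN t : t \in `[0, 1] -> hA t <> None.
  move=> tI e; apply: (gamS t tI); rewrite -hAE // e.
  by left; right; left.
have hBN t : t \in `[0, 1] -> hB t <> None.
  move=> tI e; apply: (gamS t tI); rewrite -hBE // e.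
  by left; right; right.
have cx := cont01_affine cA hAN; have cy := cont01_affine cB hBN.
set x := affine \o hA in cx; set y := affine \o hB in cy.
have xE t : t \in `[0, 1] -> hA t = Some (x t).
  by move=> tI; have := hAN t tI; rewrite /x /=; case: (hA t).
have yE t : t \in `[0, 1] -> hB t = Some (y t).
  by move=> tI; have := hBN t tI; rewrite /y /=; case: (hB t).
have ySt t : t \in `[0, 1] -> ~ S (rateval B (Some (y t))).
  by move=> tI; rewrite -yE // hBE //; exact: gamS.
have onC t : t \in `[0, 1] -> (cross_poly A B).[x t, y t] = 0.
  move=> tI; have [_ _ b0 _ _] := NS _ (ySt t tI).
  by apply/AB => //; rewrite -xE // -yE // hAE // hBE.
apply: (@connected_zero R (fun t => P.[x t, y t]) (fun t => Q.[x t, y t])).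
- exact: cont01_horner2.
- exact: cont01_horner2.
- move=> t tI; have [_ _ b0 _ _] := NS _ (ySt t tI).
  have /eqP := dEh (x t) (y t); rewrite onC // mulr0 eq_sym mulf_eq0 (negPf b0) /=.
  by rewrite mulf_eq0 => /orP[] /eqP; [left|right].
- (* A common zero of the two factors is a double root of the fibre. *)
  move=> t tI Pt Qt; have [e1 e2 b0 _ _] := NS _ (ySt t tI).
  apply: (gamS t tI); rewrite -hAE // xE //.
  left; left; left; exists (Some (x t)) => //=.
  have := congr1 (fun T : {poly {poly R[i]}} => T^`().[x t, y t]) dE.
  rewrite /= -mulrA !derivM !derivC !mul0r !add0r.
  rewrite !(hornerD, hornerM, hornerC) Pt Qt !(mulr0, mul0r) addr0 mulr0.
  move=> /eqP; rewrite !mulf_eq0 (negPf e1) (negPf e2) /=.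
  rewrite horner_deriv_cross_poly => /eqP; have := onC t tI.
  rewrite horner_cross_poly /wronskian.
  move: (numer A).[_] (denom A).[_] (numer B).[_] (denom B).[_] b0
    (numer A)^`().[_] (denom A)^`().[_] => a1 a2 b1 b2 b20 a1' a2' h1 h2.
  apply: (mulIf b20); rewrite mul0r.
  have -> : (a1' * a2 - a1 * a2') * b2 =
    a2 * (a1' * b2 - a2' * b1) - a2' * (a1 * b2 - a2 * b1) by ring.
  by rewrite h1 h2 !mulr0 subrr.
- by rewrite /x /y /= hA0 hB0.
by rewrite /x /y /= hA1 hB1.
Qed.

End Critical.

(** * Irreducible pairs have indecomposable left factors *)

(** If [z] is algebraic of degree at most [d] over a field, then so is every
    polynomial expression in [z]: its powers up to the [d]-th are linearly
    dependent. *)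
Lemma algebraic_horner (F L : fieldType) (phi : {rmorphism F -> L}) (p q : {poly F}) (z : L) :
  p != 0 -> (map_poly phi p).[z] = 0 ->
  exists r : {poly F}, [/\ r != 0, (size r <= size p)%N & (map_poly phi r).[(map_poly phi q).[z]] = 0].
Proof.
move=> p0 pz; set d := (size p).-1.
have szp : size p = d.+1 by rewrite /d prednK // size_poly_gt0.
pose M : 'M[F]_(d.+1, d) := \matrix_(j < d.+1) poly_rV (q ^+ j %% p).
have : kermx M != 0.
  rewrite kermx_eq0; apply/negP => /eqP rk.
  by have := rank_leq_col M; rewrite rk ltnn.
case/rowV0Pn => u /sub_kermxP uM u0.
exists (rVpoly u); split.
- by rewrite -(inj_eq (can_inj rVpolyK)) in u0; rewrite raddf0 in u0.
- by rewrite szp size_poly.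
have szm j : (size (q ^+ j %% p)%R <= d)%N by rewrite -ltnS -szp ltn_modp.
have sum0 : \sum_(j < d.+1) u 0 j *: (q ^+ j %% p) = 0.
  transitivity (rVpoly (u *m M)); last by rewrite uM raddf0.
  rewrite mulmx_sum_row linear_sum; apply: eq_bigr => j _.
  by rewrite linearZ /= rowK poly_rV_K.
rewrite (@horner_coef_wide _ d.+1) ?size_map_poly ?size_poly //.
transitivity (map_poly phi (\sum_(j < d.+1) u 0 j *: (q ^+ j %% p))).[z]; last first.
  by rewrite sum0 rmorph0 horner0.
rewrite rmorph_sum horner_sum.
apply: eq_bigr => j _; rewrite coef_map coef_rVpoly_ord /= map_polyZ hornerZ.
congr (_ * _); rewrite -horner_exp -rmorphXn /=.
by rewrite {1}(divp_eq (q ^+ j) p) rmorphD rmorphM /= hornerD hornerM pz mulr0 add0r.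
Qed.

Section Core.
Context {R : realType}.
Implicit Types (A B C D U : ratfun R).

(** A common left factor [U] of [A] and [B], of degree at least 2, compatible
    with the double decomposition [A o C = B o D]. *)
Definition common_left_factor A C B D : Prop :=
  exists A' B' U, [/\ nonconstant A', nonconstant B', (1 < degree U)%N
            & [/\ A = U \oR A', B = U \oR B' & A' \oR C = B' \oR D]].

Lemma degree_gt1_nonconstant A : (1 < degree A)%N -> nonconstant A.
Proof. exact: ltnW. Qed.

(** When the pair [A], [B] is irreducible, [C] has degree at least [degree A]
    over the field of the functions of [D]. *)
Lemma irreducible_pair_degree A B C D (r : {poly ratfun R}) (D0 : nonconstant D) :
  nonconstant A -> nonconstant B -> nonconstant C -> ~ reducible_pair A B ->
  A \oR C = B \oR D -> r != 0 -> (map_poly (rcomp D0) r).[C] = 0 ->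
  (degree A < size r)%N.
Proof.
move=> A0 B0 C0 nred E r0 rC; rewrite ltnNge; apply/negP => sr.
pose Phi := fibre_poly A B.
have PhiC : (map_poly (rcomp D0) Phi).[C] = 0.
  by rewrite rcomp_fibre_poly; apply/fibre_poly_root.
have Phi0 : Phi != 0 by exact: fibre_poly_neq0.
have sPhi : size Phi = (degree A).+1 by rewrite size_fibre_poly.
pose f := gcdp r Phi.
have f0 : f != 0 by rewrite gcdp_eq0 negb_and r0.
have fC : root (map_poly (rcomp D0) f) C.
  by rewrite gcdp_map root_gcd /root rC PhiC eqxx.
have sf : (1 < size f)%N.
  rewrite -(size_map_poly (rcomp D0)); apply: root_size_gt1 fC.
  by rewrite map_poly_eq0.
have sfr : (size f <= degree A)%N by apply: leq_trans (dvdp_leq r0 (dvdp_gcdl _ _)) sr.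
have /dvdpP[g gE] : f %| Phi := dvdp_gcdr _ _.
apply: (fibre_poly_irreducible A0 B0 nred gE _ sf).
rewrite ltnNge; apply/negP => sg.
have : (size Phi <= size f)%N.
  rewrite gE; apply: leq_trans (size_polyMleq _ _) _.
  by move: sg sf; case: (size g) => [|[|]] // _; case: (size f).
by rewrite sPhi leqNgt ltnS sfr.
Qed.

(** The key fact: an irreducible pair without common left factor has an
    indecomposable first member. *)
Lemma irreducible_pair_indecomposable A B C D :
  (1 < degree A)%N -> nonconstant B -> nonconstant C -> indecomposable D ->
  ~ reducible_pair A B -> ~ common_left_factor A C B D ->
  A \oR C = B \oR D -> indecomposable A.
Proof.
move=> A_1 B0 C0 [D_1 Dind] nred ncom E; split=> // A1 A2 A10 A20 AE.
have [A0 D0] := (degree_gt1_nonconstant A_1, degree_gt1_nonconstant D_1).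
have [|A11] := eqVneq (degree A1) 1%N; first by left.
have [|A21] := eqVneq (degree A2) 1%N; first by right.
exfalso; have {A11}A1_1 : (1 < degree A1)%N by rewrite ltn_neqAle eq_sym A11.
have {A21}A2_1 : (1 < degree A2)%N by rewrite ltn_neqAle eq_sym A21.
pose e := A1 \oR C; have e0 : nonconstant e by exact: ratcomp_nonconstant.
have A2e : A2 \oR e = B \oR D by rewrite /e ratcompA // -AE.
pose p := fibre_poly A2 B.
have p0 : p != 0 by exact: fibre_poly_neq0.
have pe : (map_poly (rcomp D0) p).[e] = 0.
  by rewrite rcomp_fibre_poly; apply/fibre_poly_root.
(* The field [k(D, e)], as an extension of [k(D)]; the latter is the field of
   rational functions embedded by composition with [D]. *)
pose iota := @subfx_inj _ _ (rcomp D0) e p.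
have iotaE q : iota (subfx_eval (rcomp D0) e p q) = (map_poly (rcomp D0) q).[e].
  by apply: subfx_inj_eval => //; apply/eqP.
have iotaC c : exists l, iota l = ratC c.
  exists (subfx_eval (rcomp D0) e p (ratC c)%:P).
  by rewrite iotaE map_polyC hornerC; exact: ratcomp_ratC.
have iotaD : iota (subfx_eval (rcomp D0) e p (ratX)%:P) = D.
  by rewrite iotaE map_polyC hornerC; exact: ratXcomp.
have iotae : iota (subfx_eval (rcomp D0) e p 'X) = e.
  by rewrite iotaE map_polyX hornerX.
have iotaD0 : nonconstant (iota (subfx_eval (rcomp D0) e p (ratX)%:P)) by rewrite iotaD.
have [g [G0 gE]] : exists g, nonconstant (iota g) /\ forall l, exists f, iota l = f \oR iota g.
  exact: luroth iotaC iotaD0.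
pose G := iota g; have [D' DE] := gE (subfx_eval (rcomp D0) e p (ratX)%:P).
have [e' eE] := gE (subfx_eval (rcomp D0) e p 'X).
rewrite iotaD -/G in DE; rewrite iotae -/G in eE; rewrite -/G in G0.
have outer F F' : nonconstant F -> F = F' \oR G -> nonconstant F'.
  move=> F_0 FE; apply/nonconstantP => c F'c; move/nonconstantP: F_0 => /(_ c); apply.
  by rewrite FE F'c ratcomp_ratC.
have D'0 := outer _ _ D0 DE; have e'0 := outer _ _ e0 eE.
have [G1|D'1] := Dind _ _ G0 D'0 DE.
  (* [k(D, e)] is the whole field, so [C] has degree at most [degree A2]. *)
  have [Gi [Gi1 _ GiG]] := degree1_inverse G1.
  have Gi0 : nonconstant Gi by rewrite /nonconstant Gi1.
  have [l lE] : exists l, iota l = C.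
    have [l lE] : exists l, iota l = (C \oR Gi) \oR G by exact: (image_ratcomp iotaC).
    by exists l; rewrite lE -ratcompA // GiG ratcompX.
  have [q qE] := subfxE l.
  have [r [r0 sr rC]] := @algebraic_horner _ _ (rcomp D0) p q e p0 pe.
  rewrite -iotaE -qE lE in rC.
  have := irreducible_pair_degree A0 B0 C0 nred E r0 rC.
  rewrite ltnNge; apply/negP; rewrite negbK (leq_trans sr) //.
  by rewrite size_fibre_poly // AE degree_ratcomp // ltn_Pmulr // ltnW.
(* [e] is a function of [D], so [A2] is a common left factor. *)
have [Di [Di1 _ DiD]] := degree1_inverse D'1.
have Di0 : nonconstant Di by rewrite /nonconstant Di1.
have GD : G = Di \oR D by rewrite DE ratcompA // DiD ratXcomp.
pose B1 := e' \oR Di.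
have eB1 : e = B1 \oR D by rewrite eE GD ratcompA.
have B10 : nonconstant B1 by exact: ratcomp_nonconstant.
apply: ncom; exists A1, B1, A2; split=> //; split=> //.
by apply: (ratcomp_inj D0); rewrite /= -A2e eB1 ratcompA.
Qed.

End Core.

(** * Decompositions and weak equivalence *)

Section Decomp.
Context {R : realType}.
Implicit Types (F G H A B C D U V W x y m : ratfun R) (s t u v w : seq (ratfun R)).

Lemma indecomposable_nonconstant F : indecomposable F -> nonconstant F.
Proof. by case=> /ltnW. Qed.

Lemma indecomposable_degree1_right F m : indecomposable F -> degree m = 1%N ->
  indecomposable (F \oR m).
Proof.
move=> Find m1; have F0 := indecomposable_nonconstant Find.
have m0 : nonconstant m by rewrite /nonconstant m1.
have [n [n1 mn _]] := degree1_inverse m1.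
have n0 : nonconstant n by rewrite /nonconstant n1.
split; first by rewrite degree_ratcomp // m1 muln1; case: Find.
move=> F1 F2 F10 F20 E; have FE : F = F2 \oR (F1 \oR n).
  by rewrite ratcompA // -E -ratcompA // mn ratcompX.
have F1n := ratcomp_nonconstant F10 n0.
by have := Find.2 _ _ F1n F20 FE; rewrite degree_ratcomp // n1 muln1.
Qed.

Lemma indecomposable_degree1_left F m : indecomposable F -> degree m = 1%N ->
  indecomposable (m \oR F).
Proof.
move=> Find m1; have F0 := indecomposable_nonconstant Find.
have m0 : nonconstant m by rewrite /nonconstant m1.
have [n [n1 _ nm]] := degree1_inverse m1.
have n0 : nonconstant n by rewrite /nonconstant n1.
split; first by rewrite degree_ratcomp // m1 mul1n; case: Find.
move=> F1 F2 F10 F20 E; have FE : F = (n \oR F2) \oR F1.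
  by rewrite -ratcompA // -E ratcompA // nm ratXcomp.
have F2n := ratcomp_nonconstant n0 F20.
by have := Find.2 _ _ F10 F2n FE; rewrite degree_ratcomp // n1 mul1n.
Qed.

(** The condition on the terms of a maximal decomposition. *)
Definition all_indec s : Prop := forall G, G \in s -> indecomposable G.

Lemma all_indec_cat s t : all_indec (s ++ t) <-> all_indec s /\ all_indec t.
Proof.
split=> [st|[ss tt] G]; last by rewrite mem_cat => /orP[/ss|/tt].
by split=> G Gs; apply: st; rewrite mem_cat Gs ?orbT.
Qed.

Lemma all_indec_cons x s : all_indec (x :: s) <-> indecomposable x /\ all_indec s.
Proof.
split=> [xs|[xi ss] G]; last by rewrite inE => /orP[/eqP->|/ss].
by split=> [|G Gs]; apply: xs; rewrite inE ?eqxx ?Gs ?orbT.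
Qed.

Lemma all_indec1 x : indecomposable x -> all_indec [:: x].
Proof. by move=> xi G; rewrite inE => /eqP->. Qed.

Lemma composite_nonconstant s : all_indec s -> nonconstant (composite s).
Proof.
elim: s => [|x s IH] //= /all_indec_cons[xi /IH cs].
by apply: ratcomp_nonconstant => //; exact: indecomposable_nonconstant.
Qed.

Lemma composite_cat s t : all_indec s -> all_indec t ->
  composite (s ++ t) = composite s \oR composite t.
Proof.
move=> + ti; elim: s => [|x s IH] /=.
  by rewrite ratXcomp //; exact: composite_nonconstant.
move=> /all_indec_cons[xi si].
by rewrite IH // ratcompA //; exact: composite_nonconstant.
Qed.

Lemma composite_rcons s x : all_indec s -> indecomposable x ->
  composite (rcons s x) = composite s \oR x.
Proof.
by move=> si xi; rewrite -cats1 composite_cat //= ?ratcompX //; exact: all_indec1.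
Qed.

Lemma composite_degree_gt1 s : all_indec s -> s != [::] -> (1 < degree (composite s))%N.
Proof.
case: s => // x s /all_indec_cons[xi si] _ /=.
have s0 := composite_nonconstant si.
rewrite degree_ratcomp //; last exact: indecomposable_nonconstant.
by apply: leq_trans (leq_pmulr _ s0); case: xi.
Qed.

Lemma maximal_decomposition_exists F : (1 < degree F)%N ->
  exists s, maximal_decomposition F s.
Proof.
have [n] := ubnP (degree F); elim: n F => // n IH F; rewrite ltnS => Fn F1.
have [Find|] := pselect (indecomposable F).
  by exists [:: F]; split=> //=; [exact: all_indec1 | rewrite ratcompX].
move=> /not_andP[//|] /existsNP[F1' /existsNP[F2]].
move=> /not_implyP[F10 /not_implyP[F20 /not_implyP[FE]]].
move=> /not_orP[/eqP d1 /eqP d2].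
have {}d1 : (1 < degree F1')%N by rewrite ltn_neqAle eq_sym d1.
have {}d2 : (1 < degree F2)%N by rewrite ltn_neqAle eq_sym d2.
have dF : degree F = (degree F2 * degree F1')%N by rewrite FE degree_ratcomp.
have [|s1 [s10 s1i s1E]] := IH F1' _ d1.
  by apply: leq_trans Fn; rewrite dF ltn_Pmull.
have [|s2 [s20 s2i s2E]] := IH F2 _ d2.
  by apply: leq_trans Fn; rewrite dF ltn_Pmulr // ltnW.
exists (s2 ++ s1); split.
- by case: (s2) s20.
- by apply/all_indec_cat.
- by rewrite composite_cat // -s1E -s2E.
Qed.

(** Weak equivalence without mention of the composite: the reflexive and
    transitive closure of the elementary steps. *)
Definition wstep s t : Prop := [/\ elementary_step s t, all_indec s & all_indec t].
Definition weq : relation (seq (ratfun R)) := clos_refl_trans _ wstep.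

Lemma weq_refl s : weq s s. Proof. exact: rt_refl. Qed.

Lemma weq_trans t s u : weq s t -> weq t u -> weq s u.
Proof. exact: rt_trans. Qed.

Lemma weq_sym s t : weq s t -> weq t s.
Proof.
elim=> [{}s {}t [[u [v [A [B [C [D [sE tE E]]]]]]] si ti]|{}s|{}s {}t u _ st _ tu].
- by apply: rt_step; split=> //; exists u, v, B, A, D, C.
- exact: weq_refl.
- exact: weq_trans tu st.
Qed.

Lemma weq_context u v s t : all_indec u -> all_indec v -> weq s t ->
  weq (u ++ s ++ v) (u ++ t ++ v).
Proof.
move=> ui vi.
elim=> [{}s {}t [[u' [v' [A [B [C [D [sE tE E]]]]]]] si ti]|{}s|{}s {}t t' _ st _ tu].
- apply: rt_step; split; last 2 first.
  + by apply/all_indec_cat; split=> //; apply/all_indec_cat.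
  + by apply/all_indec_cat; split=> //; apply/all_indec_cat.
  exists (u ++ u'), (v' ++ v), A, B, C, D.
  by rewrite sE tE -!catA.
- exact: weq_refl.
- exact: weq_trans st tu.
Qed.

Lemma weq_rcons v v' x : indecomposable x -> weq v v' -> weq (rcons v x) (rcons v' x).
Proof.
move=> xi vv'; have := @weq_context [::] [:: x] v v' _ (all_indec1 xi) vv'.
by rewrite /= !cats1; apply.
Qed.

Lemma weq_step u v A B C D : all_indec u -> all_indec v ->
  all_indec [:: A; C] -> all_indec [:: B; D] -> A \oR C = B \oR D ->
  weq (u ++ [:: A; C] ++ v) (u ++ [:: B; D] ++ v).
Proof.
move=> ui vi ac bd E; apply: weq_context => //; apply: rt_step; split=> //.
by exists [::], [::], A, B, C, D.
Qed.

Lemma elementary_step_composite s t : wstep s t -> composite s = composite t.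
Proof.
case=> -[u [v [A [B [C [D [-> -> E]]]]]]].
move=> /all_indec_cat[ui /all_indec_cons[Ai /all_indec_cons[Ci vi]]].
move=> /all_indec_cat[_ /all_indec_cons[Bi /all_indec_cons[Di _]]].
have cE X Y : indecomposable X -> indecomposable Y ->
    composite (u ++ [:: X, Y & v]) = composite u \oR (X \oR Y \oR composite v).
  move=> Xi Yi; rewrite composite_cat //=; last first.
    by apply/all_indec_cons; split=> //; apply/all_indec_cons.
  rewrite -ratcompA //; first exact: indecomposable_nonconstant.
  exact: composite_nonconstant.
by rewrite !cE // E.
Qed.

Lemma equivalent_refl s : s != [::] -> all_indec s -> equivalent s s.
Proof.
move=> s0 si; split=> //; case: (ltngtP (size s) 1%N) => [|s2|s1].
- by case: s s0 {si}.
- right; split=> //; exists (fun=> ratX), (fun=> ratX).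
  have d0 i : nonconstant (dterm s i).
    rewrite /dterm; have [is_|is_] := ssrnat.ltnP i.-1 (size (rev s)).
      by apply: indecomposable_nonconstant; apply: si; rewrite -mem_rev mem_nth.
    by rewrite nth_default.
  by split=> [i _||i _|]; rewrite ?ratXcomp ?ratcompX ?degree_ratX //; exact: ratcomp_nonconstant.
- by left.
Qed.

Lemma weq_weakly_equivalent F d e : maximal_decomposition F d -> weq d e ->
  weakly_equivalent F d e.
Proof.
move=> + de; have {}de := clos_rt_rt1n _ _ _ _ de.
elim: de => [s [s0 si sE]|s t {}e st te IH [s0 si sE]].
  exists 0%N, (fun=> s); split=> //.
  exact: equivalent_refl.
have tE := elementary_step_composite st.
have [[u [v [A [B [C [D [_ tuv _]]]]]]] _ ti] := st.
have [|n [c [cm c0 cn cs]]] := IH.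
  split=> //; last by rewrite -tE.
  by rewrite tuv; case: (u).
exists n.+1, (fun i => if i is j.+1 then c j else s); split=> //.
- by case=> [_|i lin]; [split | exact: cm].
- by case=> [|i] lin; [rewrite c0; case: st | exact: cs].
Qed.

(** Equivalence of decompositions, read from the left: the head [x] of the
    first one is the head [y] of the second one followed by a function of
    degree 1, whose inverse is absorbed by the next term. *)
Fixpoint head_equiv x s y t : Prop :=
  match s, t with
  | [::], [::] => x = y
  | a :: s', b :: t' => exists m,
      [/\ degree m = 1%N, x = y \oR m & head_equiv (m \oR a) s' b t']
  | _, _ => False
  end.

(** An equivalence is a chain of elementary steps: each one moves a function of
    degree 1 from a term to the next one. *)
Lemma head_equiv_weq u x s y t : all_indec u -> all_indec (x :: s) -> all_indec (y :: t) ->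
  head_equiv x s y t -> weq (u ++ x :: s) (u ++ y :: t).
Proof.
elim: s t u x y => [|a s IH] [|b t] u x y //= ui xs yt.
  by move=> ->; exact: weq_refl.
case=> m [m1 xE H].
have [xi /all_indec_cons[ai si]] := iffLR (all_indec_cons _ _) xs.
have [yi ti] := iffLR (all_indec_cons _ _) yt.
have mai := indecomposable_degree1_left ai m1.
apply: (@weq_trans (u ++ [:: y; m \oR a] ++ s)).
  apply: (@weq_step u s x y a (m \oR a)) => //.
  - by apply/all_indec_cons; split=> //; exact: all_indec1.
  - by apply/all_indec_cons; split=> //; exact: all_indec1.
  have m0 : nonconstant m by rewrite /nonconstant m1.
  by rewrite xE ratcompA //; exact: indecomposable_nonconstant.
have -> : u ++ [:: y; m \oR a] ++ s = rcons u y ++ (m \oR a) :: s.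
  by rewrite cat_rcons.
rewrite -[u ++ y :: b :: t]cat_rcons; apply: IH => //.
  by rewrite -cats1; apply/all_indec_cat; split=> //; exact: all_indec1.
by apply/all_indec_cons.
Qed.

Lemma dterm_cons x s i : (i.-1 < size s)%N -> dterm (x :: s) i = dterm s i.
Proof. by move=> si; rewrite /dterm rev_cons nth_rcons size_rev si. Qed.

Lemma dterm_head x s : dterm (x :: s) (size s).+1 = x.
Proof. by rewrite /dterm rev_cons nth_rcons size_rev /= ltnn eqxx. Qed.

Lemma head_equivI x s y t (mu nu : nat -> ratfun R) : all_indec s -> all_indec t ->
  size t = size s ->
  (forall i, (0 < i <= size s)%N -> degree (mu i) = 1%N /\ mu i \oR nu i = ratX /\ degree (nu i) = 1%N) ->
  x = (if size s is 0 then y else y \oR mu (size s)) ->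
  (forall i, (1 < i <= size s)%N -> dterm s i = nu i \oR dterm t i \oR mu i.-1) ->
  (s != [::] -> dterm s 1 = nu 1%N \oR dterm t 1) ->
  head_equiv x s y t.
Proof.
elim: s t x y => [|a s IH] [|b t] x y //= si ti [st] hmu xE hd h1.
have [ai si'] := iffLR (all_indec_cons _ _) si.
have [bi ti'] := iffLR (all_indec_cons _ _) ti.
have [m1 [mn n1]] := hmu (size s).+1 (ltnSn _).
have m0 : nonconstant (mu (size s).+1) by rewrite /nonconstant m1.
have n0 : nonconstant (nu (size s).+1) by rewrite /nonconstant n1.
have b0 := indecomposable_nonconstant bi.
exists (mu (size s).+1); split=> //; apply: IH => //.
- by move=> i /andP[i0 i_s]; apply: hmu; rewrite i0 ltnW.
- have bE : dterm (b :: t) (size s).+1 = b by rewrite -st dterm_head.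
  case E : (size s) => [|k].
    have := h1 isT; rewrite -{1}[1%N]/(0.+1) -{1}E dterm_head => ->.
    move: bE mn n0 m0; rewrite E => -> mn n0 m0.
    by rewrite ratcompA // mn ratXcomp.
  have := hd (size s).+1; rewrite dterm_head bE /= E => ->; last by rewrite !ltnS leqnn.
  have k0 : nonconstant (mu k.+1).
    by have [|d1 _] := hmu k.+1; rewrite ?E ?ltnS ?leqnSn // /nonconstant d1.
  rewrite E in mn n0 m0.
  have nb0 := ratcomp_nonconstant n0 b0.
  by rewrite !ratcompA // mn ratXcomp.
- move=> i /andP[i1 i_s]; have := hd i; rewrite !dterm_cons ?st; last 2 first.
  + by case: (i) i1 i_s.
  + by case: (i) i1 i_s.
  by apply; rewrite i1 ltnW.
- move=> s0; have := h1 isT; rewrite !dterm_cons //= ?st.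
  by case: (s) s0. by case: (s) s0.
Qed.

Lemma equivalent_weq s t : all_indec s -> all_indec t -> equivalent s t -> weq s t.
Proof.
case: s => [|x s]; case: t => [|y t] si ti [] //=.
  by move=> _ _; exact: weq_refl.
move=> [st].
have [xi si'] := iffLR (all_indec_cons _ _) si.
have [yi ti'] := iffLR (all_indec_cons _ _) ti.
case=> [[[s0] xy]|[s2 [mu [nu [hmu hx hd h1]]]]].
  move: s0 st xy => /size0nil -> /size0nil ->; rewrite /dterm /= => ->.
  exact: weq_refl.
apply: (@head_equiv_weq [::]) => //.
apply: (@head_equivI _ _ _ _ mu nu) => //.
- by move=> i ilt; have [? ? ? ?] := hmu i ilt.
- move: hx; rewrite dterm_head -{1}st dterm_head => ->.
  by move: s2; rewrite ltnS /=; case: (size s).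
- move=> i /andP[i1 i_s]; have := hd i; rewrite !dterm_cons ?st; last 2 first.
  + by case: (i) i1 i_s.
  + by case: (i) i1 i_s.
  by apply; rewrite i1 ltnS.
- by rewrite !dterm_cons ?st // in h1.
Qed.

Lemma weakly_equivalent_weq F d e : all_indec e -> weakly_equivalent F d e -> weq d e.
Proof.
move=> ei [n [c [cm <- cn cs]]].
have ci i : (i <= n)%N -> all_indec (c i) by move=> /cm[].
apply: (@weq_trans (c n)); last by apply: equivalent_weq => //; exact: ci.
have H i : (i <= n)%N -> weq (c 0%N) (c i).
  elim: i => [|i IH] lin; first exact: weq_refl.
  apply: (weq_trans (IH (ltnW lin))); apply: rt_step; split; first exact: cs.
    exact: ci (ltnW lin).
  exact: ci.
exact: H.
Qed.

End Decomp.

(** * Double decompositions *)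

Section Main.
Context {R : realType}.
Implicit Types (F G H A B C D U V W x y m : ratfun R) (s t u v w : seq (ratfun R)).

Lemma reducible_pair_sym A B : reducible_pair A B -> reducible_pair B A.
Proof.
move=> [S [z [Sf SA SB Sz nt]]]; exists S, z; split=> // tr; apply: nt.
move=> a a' b b' ha ha' hb hb'.
by have [g [gl gb ga]] := tr b b' a a' hb hb' ha ha'; exists g.
Qed.

Lemma common_left_factor_sym A C B D : common_left_factor A C B D ->
  common_left_factor B D A C.
Proof. by move=> [A' [B' [U [A0 B0 U1 [AE BE E]]]]]; exists B', A', U. Qed.

Lemma maximal_decomposition_rcons F v x : maximal_decomposition F (rcons v x) ->
  [/\ all_indec v, indecomposable x & F = composite v \oR x].
Proof.
case=> _ vx ->; move: vx; rewrite -cats1 => /all_indec_cat[vi xi].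
have {}xi : indecomposable x by apply: xi; rewrite inE eqxx.
by rewrite cats1 composite_rcons.
Qed.

Lemma maximal_decomposition_composite s : all_indec s -> s != [::] ->
  maximal_decomposition (composite s) s.
Proof. by move=> si s0; split. Qed.

Lemma maximal_decomposition_indecomposable F s : indecomposable F ->
  maximal_decomposition F s -> s = [:: F].
Proof.
move=> [_ Find]; case/lastP: s => [[]//|w x] /maximal_decomposition_rcons[wi xi FE].
have [w0|w0] := eqVneq w [::].
  by rewrite FE w0 /= ratXcomp //; exact: indecomposable_nonconstant.
have [x1 w1] := (xi.1, composite_degree_gt1 wi w0).
by case: (Find _ _ (ltnW x1) (ltnW w1) FE) => E; [rewrite E in x1 | rewrite E in w1].
Qed.

Variable K : set (ratfun R).
Hypothesis Kclosed : closed_class K.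
Hypothesis Kspecial : forall P V V1 W W1, K P ->
  special_double_decomposition P V V1 W W1 ->
  forall v w, maximal_decomposition V v -> maximal_decomposition W w ->
    weakly_equivalent P (rcons v V1) (rcons w W1).

Lemma closed_comp A B : nonconstant A -> nonconstant B -> K (A \oR B) -> K A /\ K B.
Proof. by move=> A0 B0 KAB; apply: (Kclosed.2 _ _ _ KAB). Qed.

(** Two decompositions whose rightmost terms differ by a function [m] of
    degree 1 reduce to two decompositions of [composite w]. *)
Lemma weq_last_degree1 v w x y m : all_indec v -> all_indec w ->
  indecomposable x -> indecomposable y -> v != [::] -> w != [::] ->
  degree m = 1%N -> x = m \oR y -> composite v \oR x = composite w \oR y ->
  (forall s, maximal_decomposition (composite w) s -> weq s w) ->
  weq (rcons v x) (rcons w y).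
Proof.
case/lastP: v => // v a vai wi xi yi _ w0 m1 xE E IH.
have m0 : nonconstant m by rewrite /nonconstant m1.
have y0 := indecomposable_nonconstant yi.
have [vi ai] : all_indec v /\ indecomposable a.
  move: vai; rewrite -cats1 => /all_indec_cat[? a1]; split=> //.
  by apply: a1; rewrite inE eqxx.
have ami := indecomposable_degree1_right ai m1.
apply: (@weq_trans _ (rcons (rcons v (a \oR m)) y)).
  have := @weq_step _ v [::] a (a \oR m) x y vi.
  rewrite !cats0 -!cats1 -!catA /=; apply=> //.
  - by apply/all_indec_cons; split=> //; exact: all_indec1.
  - by apply/all_indec_cons; split=> //; exact: all_indec1.
  by rewrite xE ratcompA.
apply: weq_rcons => //; apply: IH.
have vami : all_indec (rcons v (a \oR m)).
  by rewrite -cats1; apply/all_indec_cat; split=> //; exact: all_indec1.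
split=> //; first by case: (v).
apply: (ratcomp_inj y0); rewrite /= -E xE composite_rcons // composite_rcons //.
have a0 := indecomposable_nonconstant ai.
by rewrite !ratcompA.
Qed.

(** The induction on the degree of [F]. *)
Lemma maximal_decompositions_weq F d e : K F -> maximal_decomposition F d ->
  maximal_decomposition F e -> weq d e.
Proof.
have [n] := ubnP (degree F); elim: n F d e => // n IH F d e; rewrite ltnS => Fn KF dm em.
have [Find|Fnind] := pselect (indecomposable F).
  rewrite (maximal_decomposition_indecomposable Find dm).
  by rewrite (maximal_decomposition_indecomposable Find em); exact: weq_refl.
have IH' G s t : (degree G < degree F)%N -> K G -> maximal_decomposition G s ->
    maximal_decomposition G t -> weq s t.
  by move=> GF; apply: IH; exact: leq_trans Fn.
case/lastP: d dm => [[]//|v V1] dm; case/lastP: e em => [[]//|w W1] em.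
have [vi V1i VE] := maximal_decomposition_rcons dm.
have [wi W1i WE] := maximal_decomposition_rcons em.
have nilF x s : indecomposable x -> F = composite s \oR x -> s != [::].
  move=> xi FE; apply/eqP => s0; apply: Fnind.
  by rewrite FE s0 /= ratXcomp //; exact: indecomposable_nonconstant.
have v0 := nilF _ _ V1i VE; have w0 := nilF _ _ W1i WE.
have V_1 := composite_degree_gt1 vi v0; have W_1 := composite_degree_gt1 wi w0.
have vm := maximal_decomposition_composite vi v0.
have wm := maximal_decomposition_composite wi w0.
set V := composite v in VE V_1 vm *; set W := composite w in WE W_1 wm *.
have [V0 W0] : nonconstant V /\ nonconstant W by split; exact: ltnW.
have [V10 W10] := (indecomposable_nonconstant V1i, indecomposable_nonconstant W1i).
have [KV _] : K V /\ K V1 by apply: closed_comp => //; rewrite -VE.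
have [KW _] : K W /\ K W1 by apply: closed_comp => //; rewrite -WE.
have VF : (degree V < degree F)%N.
  by rewrite VE degree_ratcomp // ltn_Pmulr //; case: V1i.
have WF : (degree W < degree F)%N.
  by rewrite WE degree_ratcomp // ltn_Pmulr //; case: W1i.
have EVW : V \oR V1 = W \oR W1 by rewrite -VE.
have last1 A B x y : nonconstant B -> indecomposable x -> indecomposable y ->
    degree A = 1%N -> A \oR x = B \oR y -> exists2 m, degree m = 1%N & x = m \oR y.
  move=> B0 xi yi A1 E; have [Ai [Ai1 _ AiA]] := degree1_inverse A1.
  have A0 : nonconstant A by rewrite /nonconstant A1.
  have Ai0 : nonconstant Ai by rewrite /nonconstant Ai1.
  have [x0 y0] := (indecomposable_nonconstant xi, indecomposable_nonconstant yi).
  have xE : x = (Ai \oR B) \oR y.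
    by rewrite -ratcompA // -E ratcompA // AiA ratXcomp.
  exists (Ai \oR B) => //.
  have [y1|//] := xi.2 _ _ y0 (ratcomp_nonconstant Ai0 B0) xE.
  by case: yi; rewrite y1.
have [[A' [B' [U [A'0 B'0 U1 [AE BE E]]]]]|ncom] := pselect (common_left_factor V V1 W W1).
  have U0 : nonconstant U by exact: ltnW.
  have [A'1|A'1] := eqVneq (degree A') 1%N.
    have [m m1 mE] := last1 _ _ _ _ B'0 V1i W1i A'1 E.
    by apply: (weq_last_degree1 vi wi V1i W1i v0 w0 m1 mE EVW) => s sm; exact: IH' sm wm.
  have [B'1|B'1] := eqVneq (degree B') 1%N.
    have [m m1 mE] := last1 _ _ _ _ A'0 W1i V1i B'1 (esym E).
    apply: weq_sym; apply: (weq_last_degree1 wi vi W1i V1i w0 v0 m1 mE (esym EVW)).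
    by move=> s sm; exact: IH' sm vm.
  have {}A'1 : (1 < degree A')%N by rewrite ltn_neqAle eq_sym A'1.
  have {}B'1 : (1 < degree B')%N by rewrite ltn_neqAle eq_sym B'1.
  have [u um] := maximal_decomposition_exists U1.
  have [a am] := maximal_decomposition_exists A'1.
  have [b bm] := maximal_decomposition_exists B'1.
  have [un ui uE] := um; have [an ai aE] := am; have [bn bi bE] := bm.
  have A'V1 := ratcomp_nonconstant A'0 V10.
  have FU : F = U \oR (A' \oR V1) by rewrite ratcompA // -AE.
  have [_ KA'V1] : K U /\ K (A' \oR V1) by apply: closed_comp => //; rewrite -FU.
  (* [V = U o A'], [A' o V1 = B' o W1] and [U o B' = W] are treated in turn. *)
  have step1 : weq v (u ++ a).
    apply: (IH' V) => //; split.
    - by case: (u) un.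
    - by apply/all_indec_cat.
    - by rewrite composite_cat // -uE -aE.
  have step3 : weq (u ++ b) w.
    apply: (IH' W) => //; split.
    - by case: (u) un.
    - by apply/all_indec_cat.
    - by rewrite composite_cat // -uE -bE.
  have step2 : weq (rcons a V1) (rcons b W1).
    apply: (IH' (A' \oR V1)) => //.
    - by rewrite FU (degree_ratcomp U0 A'V1) ltn_Pmull.
    - split; first by case: (a).
        by rewrite -cats1; apply/all_indec_cat; split=> //; exact: all_indec1.
      by rewrite composite_rcons // -aE.
    split; first by case: (b).
      by rewrite -cats1; apply/all_indec_cat; split=> //; exact: all_indec1.
    by rewrite composite_rcons // -bE.
  apply: (weq_trans (weq_rcons V1i step1)).
  apply: (@weq_trans _ (rcons (u ++ b) W1)); last exact: weq_rcons.
  rewrite !rcons_cat; have := @weq_context _ u [::] _ _ ui _ step2.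
  by rewrite !cats0; apply.
(* Without common left factor, the double decomposition is special as soon as
   the pair is reducible. *)
have [red|nred] := pselect (reducible_pair V W).
  have special : special_double_decomposition F V V1 W W1 by [].
  have wE := Kspecial KF special vm wm.
  by apply: weakly_equivalent_weq wE; case: em.
have Vi : indecomposable V.
  exact: irreducible_pair_indecomposable V_1 W0 V10 W1i nred ncom EVW.
have Wi : indecomposable W.
  apply: (irreducible_pair_indecomposable W_1 V0 W10 V1i _ _ (esym EVW)).
    by move=> /reducible_pair_sym.
  by move=> /common_left_factor_sym.
rewrite (maximal_decomposition_indecomposable Vi vm).
rewrite (maximal_decomposition_indecomposable Wi wm) /=.
apply: (@weq_step _ [::] [::]) => //.
- by apply/all_indec_cons; split=> //; exact: all_indec1.
- by apply/all_indec_cons; split=> //; exact: all_indec1.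
Qed.

End Main.

Theorem theorem5p1 (R : realType) (K : set (ratfun R)) :
  closed_class K ->
  (forall P V V1 W W1 : ratfun R,
     K P ->
     special_double_decomposition P V V1 W W1 ->
     forall v w : seq (ratfun R),
       maximal_decomposition V v ->
       maximal_decomposition W w ->
       weakly_equivalent P (rcons v V1) (rcons w W1)) ->
  ritt_class K.
Proof.
move=> Kcl Ksp; split=> // F d e KF dm em.
exact/(weq_weakly_equivalent dm)/(maximal_decompositions_weq Kcl Ksp KF dm em).
Qed.
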